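(* Let $f:M\to\mathbb{R}^{n+1}$ be a centroaffine ovaloid, let $\nabla$ be its induced connection, $g$ its second fundamental form and $\overline\nabla$ the dual connection of $\nabla$ relative to $g$. Then $\nabla$ and $\overline\nabla$ are both complete.
   Context: Let $f:M\to\mathbb{R}^{n+1}$ be an immersed hypersurface ($\dim M=n$) with a transversal vector field $\xi$. The induced connection $\nabla$ (torsion-free) and the second fundamental form $g$ (a symmetric $(0,2)$-tensor field) are defined by the Gauss formula $D_Xf_*Y=f_*\nabla_XY+g(X,Y)\xi$, where $D$ is the standard flat connection on $\mathbb{R}^{n+1}$. The hypersurface is non-degenerate if $g$ is non-degenerate (a property independent of the choice of $\xi$). An ovaloid is a non-degenerate hypersurface $f:M\to\mathbb{R}^{n+1}$ with $M$ diffeomorphic to the Euclidean sphere $S^n$; it is then locally strongly convex, i.e. $g$ is definite, and the sign of $\xi$ is chosen so that $g$ is positive definite. The hypersurface is centroaffine (has a centroaffine normalization) if $\xi$ is a non-zero constant multiple of the position vector field relative to a fixed point of $\mathbb{R}^{n+1}$ (the center, not belonging to the hypersurface), this position vector field being transversal to $f$. The dual connection $\overline\nabla$ of $\nabla$ relative to $g$ is defined by $Xg(Y,Z)=g(\nabla_XY,Z)+g(Y,\overline\nabla_XZ)$. A connection is complete if each of its maximal geodesics, parametrized by an affine parameter, is defined on all of $\mathbb{R}$. *)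

(* Defs.v *)
From mathcomp Require Import all_boot all_order all_algebra.
From mathcomp Require Import all_classical all_reals all_analysis.
Import Order.TTheory GRing.Theory Num.Theory.
Import numFieldNormedType.Exports.

Set Implicit Arguments.
Unset Strict Implicit.
Unset Printing Implicit Defensive.

Local Open Scope classical_set_scope.
Local Open Scope ring_scope.

(* C^k and C^oo maps on an open subset U of a finite-dimensional space: the
   directional derivatives of order < k are differentiable, those of order k
   are continuous. *)
Fixpoint Ck (R : realType) (V W : normedModType R) (k : nat) (U : set V)
    (f : V -> W) : Prop :=
  match k with
  | 0 => forall x, U x -> {for x, continuous f}
  | k'.+1 => (forall x, U x -> differentiable f x) /\
             forall v : V, Ck k' U (fun x => 'D_v f x)
  end.

Definition smooth_on (R : realType) (V W : normedModType R) (U : set V)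
    (f : V -> W) : Prop :=
  forall k : nat, Ck k U f.

(* [coord] and [param] are total functions, meaningful only on [dom] and on
   [coord @` dom] respectively, where they are inverse homeomorphisms. *)
Record chart (R : realType) (n : nat) (M : topologicalType) := Chart {
  dom : set M;
  coord : M -> 'rV[R]_n;
  param : 'rV[R]_n -> M;
  dom_open : open dom;
  coord_dom_open : open (coord @` dom);
  coordK : forall p, dom p -> param (coord p) = p;
  coord_continuous : forall p, dom p -> {for p, continuous coord};
  param_continuous : forall x, (coord @` dom) x -> {for x, continuous param}
}.

Definition img (R : realType) (n : nat) (M : topologicalType)
    (c : chart R n M) : set 'rV[R]_n := coord c @` dom c.

Definition transition (R : realType) (n : nat) (M : topologicalType)
    (c d : chart R n M) : 'rV[R]_n -> 'rV[R]_n := coord d \o param c.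

Definition overlap (R : realType) (n : nat) (M : topologicalType)
    (c d : chart R n M) : set 'rV[R]_n :=
  [set x | img c x /\ dom d (param c x)].

(* The atlas need not be maximal: nothing below depends on the choice of an
   atlas within its equivalence class. *)
Record smooth_manifold (R : realType) (n : nat) := SmoothManifold {
  carrier :> topologicalType;
  atlas : set (chart R n carrier);
  manifold_hausdorff : hausdorff_space carrier;
  manifold_second_countable : @second_countable carrier;
  atlas_cover : forall p : carrier, exists2 c, atlas c & dom c p;
  atlas_smooth : forall c d, atlas c -> atlas d ->
    smooth_on (overlap c d) (transition c d)
}.

Definition smooth_map (R : realType) (n m : nat) (M : smooth_manifold R n)
    (f : M -> 'rV[R]_m) : Prop :=
  forall c, atlas c -> smooth_on (img c) (f \o param c).

(* The norm of 'rV[R]_m in the library is the sup norm, hence the explicit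
   sum of squares. *)
Definition unit_sphere (R : realType) (m : nat) : set 'rV[R]_m :=
  [set y | \sum_(i < m) y 0 i ^+ 2 = 1].

(* Smoothness of a map k from the submanifold S^n of R^(n+1) to M: around each
   point of S^n, the map k read in a chart of M is the restriction of a smooth
   map defined on an open subset of R^(n+1). *)
Definition smooth_from_sphere (R : realType) (n : nat)
    (M : smooth_manifold R n) (k : 'rV[R]_n.+1 -> M) : Prop :=
  forall (y : 'rV[R]_n.+1) (c : chart R n M),
    unit_sphere y -> atlas c -> dom c (k y) ->
    exists (U : set 'rV[R]_n.+1) (G : 'rV[R]_n.+1 -> 'rV[R]_n),
      [/\ open U, U y, smooth_on U G &
          forall z, U z -> unit_sphere z ->
            dom c (k z) /\ coord c (k z) = G z].

Definition diffeomorphic_to_sphere (R : realType) (n : nat)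
    (M : smooth_manifold R n) : Prop :=
  exists (h : M -> 'rV[R]_n.+1) (k : 'rV[R]_n.+1 -> M),
    [/\ forall p, unit_sphere (h p),
        forall p, k (h p) = p,
        forall y, unit_sphere y -> h (k y) = y,
        smooth_map h &
        smooth_from_sphere k].

(* A symmetric (0,2)-tensor field, given by its components in the charts:
   [form c x v w] is its value on the tangent vectors with components v and w
   in the chart c, at the point with coordinates x. *)
Record sym_tensor2 (R : realType) (n : nat) (M : smooth_manifold R n) :=
  SymTensor2 {
  form :> chart R n M -> 'rV[R]_n -> 'rV[R]_n -> 'rV[R]_n -> R;
  form_linear : forall c x v, atlas c -> img c x -> scalar (form c x v);
  form_sym : forall c x v w, atlas c -> img c x ->
    form c x v w = form c x w v;
  form_smooth : forall c v w, atlas c ->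
    smooth_on (img c) (fun x => form c x v w);
  form_transform : forall c d x v w, atlas c -> atlas d -> overlap c d x ->
    form d (transition c d x)
      ('d (transition c d) x v) ('d (transition c d) x w) = form c x v w
}.

(* An affine connection, given by its Christoffel symbols in the charts:
   [christoffel c x v w] has k-th component the sum of Gamma^k_ij v^i w^j.
   The last field is their transformation law. *)
Record connection (R : realType) (n : nat) (M : smooth_manifold R n) :=
  Connection {
  christoffel :
    chart R n M -> 'rV[R]_n -> 'rV[R]_n -> 'rV[R]_n -> 'rV[R]_n;
  christoffel_linearl : forall c x w, atlas c -> img c x ->
    linear (fun v => christoffel c x v w);
  christoffel_linearr : forall c x v, atlas c -> img c x ->
    linear (christoffel c x v);
  christoffel_smooth : forall c v w, atlas c ->
    smooth_on (img c) (fun x => christoffel c x v w);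
  christoffel_transform : forall c d x v w, atlas c -> atlas d ->
    overlap c d x ->
    'd (transition c d) x (christoffel c x v w) =
      'D_v (fun y => 'D_w (transition c d) y) x +
      christoffel d (transition c d x)
        ('d (transition c d) x v) ('d (transition c d) x w)
}.

(* nabla_X Y for vector fields X, Y on the domain of the chart c, all read in
   that chart. *)
Definition covariant (R : realType) (n : nat) (M : smooth_manifold R n)
    (nabla : connection M) (c : chart R n M) (X Y : 'rV[R]_n -> 'rV[R]_n)
    (x : 'rV[R]_n) : 'rV[R]_n :=
  'D_(X x) Y x + christoffel nabla c x (X x) (Y x).

(* f_* v, for the tangent vector with components v in the chart c at the point
   with coordinates x. *)
Definition pushforward (R : realType) (n m : nat) (M : smooth_manifold R n)
    (f : M -> 'rV[R]_m) (c : chart R n M) (x v : 'rV[R]_n) : 'rV[R]_m :=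
  'd (f \o param c) x v.

Definition immersion (R : realType) (n m : nat) (M : smooth_manifold R n)
    (f : M -> 'rV[R]_m) : Prop :=
  smooth_map f /\
  forall c x, atlas c -> img c x -> injective (pushforward f c x).

Definition transversal (R : realType) (n : nat) (M : smooth_manifold R n)
    (f xi : M -> 'rV[R]_n.+1) : Prop :=
  smooth_map xi /\
  forall c x v, atlas c -> img c x -> pushforward f c x v <> xi (param c x).

(* D_X f_* Y = f_* nabla_X Y + g(X,Y) xi *)
Definition gauss_formula (R : realType) (n : nat) (M : smooth_manifold R n)
    (f xi : M -> 'rV[R]_n.+1) (nabla : connection M) (g : sym_tensor2 M) :
    Prop :=
  forall (c : chart R n M) (X Y : 'rV[R]_n -> 'rV[R]_n) (x : 'rV[R]_n),
    atlas c -> smooth_on (img c) X -> smooth_on (img c) Y -> img c x ->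
    'D_(X x) (fun y => pushforward f c y (Y y)) x =
      pushforward f c x (covariant nabla c X Y x) +
      g c x (X x) (Y x) *: xi (param c x).

Definition nondegenerate (R : realType) (n : nat) (M : smooth_manifold R n)
    (g : sym_tensor2 M) : Prop :=
  forall c x v, atlas c -> img c x -> (forall w, g c x v w = 0) -> v = 0.

Definition positive_definite (R : realType) (n : nat)
    (M : smooth_manifold R n) (g : sym_tensor2 M) : Prop :=
  forall c x v, atlas c -> img c x -> v != 0 -> 0 < g c x v v.

Definition negative_definite (R : realType) (n : nat)
    (M : smooth_manifold R n) (g : sym_tensor2 M) : Prop :=
  forall c x v, atlas c -> img c x -> v != 0 -> g c x v v < 0.

(* The second fundamental form of an ovaloid is definite; the sign of the
   transversal field is then chosen to make it positive definite.  Only the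
   choice of sign is required here: definiteness is a consequence of
   nondegeneracy and of the shape of the manifold. *)
Definition sign_convention (R : realType) (n : nat)
    (M : smooth_manifold R n) (g : sym_tensor2 M) : Prop :=
  positive_definite g \/ negative_definite g -> positive_definite g.

Definition ovaloid (R : realType) (n : nat) (M : smooth_manifold R n)
    (f : M -> 'rV[R]_n.+1) (g : sym_tensor2 M) : Prop :=
  [/\ diffeomorphic_to_sphere M, immersion f, nondegenerate g &
      sign_convention g].

(* That the position vector field relative to o is transversal, and hence that
   o is not on the hypersurface, is part of [transversal f xi]. *)
Definition centroaffine (R : realType) (n : nat) (M : smooth_manifold R n)
    (f xi : M -> 'rV[R]_n.+1) : Prop :=
  transversal f xi /\
  exists (o : 'rV[R]_n.+1) (a : R),
    a != 0 /\ forall p, xi p = a *: (f p - o).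

(* X g(Y,Z) = g(nabla_X Y, Z) + g(Y, nabla'_X Z) *)
Definition dual_connection (R : realType) (n : nat) (M : smooth_manifold R n)
    (g : sym_tensor2 M) (nabla nabla' : connection M) : Prop :=
  forall (c : chart R n M) (X Y Z : 'rV[R]_n -> 'rV[R]_n) (x : 'rV[R]_n),
    atlas c -> smooth_on (img c) X -> smooth_on (img c) Y ->
    smooth_on (img c) Z -> img c x ->
    'D_(X x) (fun y => g c y (Y y) (Z y)) x =
      g c x (covariant nabla c X Y x) (Z x) +
      g c x (Y x) (covariant nabla' c X Z x).

(* An affinely parametrized geodesic on the open interval I: in each chart,
   u'' + Gamma(u)(u', u') = 0. The values of gamma outside I are irrelevant. *)
Definition geodesic (R : realType) (n : nat) (M : smooth_manifold R n)
    (nabla : connection M) (I : set R) (gamma : R -> M) : Prop :=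
  [/\ open I, I !=set0, is_interval I,
      forall t, I t -> {for t, continuous gamma} &
      forall c t, atlas c -> I t -> dom c (gamma t) ->
        let u := coord c \o gamma in
        [/\ derivable u t 1, derivable (derive1 u) t 1 &
            derive1 (derive1 u) t +
              christoffel nabla c (u t) (derive1 u t) (derive1 u t) = 0]].

Definition maximal_geodesic (R : realType) (n : nat) (M : smooth_manifold R n)
    (nabla : connection M) (I : set R) (gamma : R -> M) : Prop :=
  geodesic nabla I gamma /\
  forall (J : set R) (delta : R -> M), geodesic nabla J delta ->
    I `<=` J -> (forall t, I t -> delta t = gamma t) -> J = I.

Definition complete_connection (R : realType) (n : nat)
    (M : smooth_manifold R n) (nabla : connection M) : Prop :=
  forall (I : set R) (gamma : R -> M),
    maximal_geodesic nabla I gamma -> I = setT.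

(* Main.v *)
From HB Require Import structures.
Require Import Defs.
From mathcomp Require Import all_boot all_order all_algebra.
From mathcomp Require Import all_classical all_reals all_analysis.
From mathcomp Require Import perm ring lra.
Require Import Defs.
Import Order.TTheory GRing.Theory Num.Theory.
Import numFieldNormedType.Exports.

Set Implicit Arguments.
Unset Strict Implicit.
Unset Printing Implicit Defensive.

Local Open Scope classical_set_scope.
Local Open Scope ring_scope.

(** A geodesic of either connection is controlled by a quantity of the ambient
    space that does not change along it.

    Let [N] be the position vector, relative to the center, along a geodesic of
    [nabla].  The transversal field is [a N], so by the Gauss formula [N''] is
    the multiple [a g(gamma', gamma') N] of [N], and the bivector [N /\ N'] is
    constant: this is Kepler's law of areas ([areal_velocity_constant]).  Since
    [N] is transversal to the hypersurface, a tangent vector [v] is determined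
    by [N /\ v], and [N /\ v] depends linearly on [v].  So the velocity is
    bounded near every point, by a constant that is valid for all times.

    The dual connection is the connection induced by the conormal map [nu],
    which is again centroaffine, so that [nu /\ nu'] is constant along its
    geodesics.  As an alternating form on the ambient space, a multiple of
    [nu /\ nu'] is characterised by its values in the frame formed by [N] and
    the coordinate vectors: it vanishes on pairs of tangent vectors, and
    pairs [N] with [w] to [g(gamma', w)].  If [A] is the matrix of the frame,
    [W] that of the form and [S] that of its values, then [A W A^T = S].  The
    Gauss formula reads [A' = T A], duality together with the equation of
    geodesics reads [S' = T S + S T^T], and hence [W' = 0]
    ([conormal_bivector_constant]).  Here it is the non-degeneracy of [g] that
    turns the constancy of [W] into a bound for the velocity.

    It remains to see that a maximal geodesic whose velocity is locally bounded
    is defined for all times ([maximal_geodesic_complete]).  Suppose that it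
    ends at a finite time [b].  Its image in the sphere is Lipschitz by
    compactness, so the curve converges at [b]; in a chart around the limit the
    acceleration is bounded, by the equation of geodesics, so the velocity
    converges as well.  The solution of the equation that starts at time [b]
    from these limits ([picard], [geodesic_local_existence]) continues the
    geodesic: the mean value theorem shows that the two pieces fit to second
    order.  This contradicts maximality. *)

(** * Matrices: norms, limits and derivatives *)

Section MatrixNorm.
Context {R : realType}.

Lemma mx_entry_le m n (A : 'M[R]_(m, n)) i j : `|A i j| <= `|A|.
Proof.
rewrite [leRHS]/Num.norm /= mx_normrE.
exact: (le_bigmax _ (fun ij => `|A ij.1 ij.2|) (i, j)).
Qed.

Lemma mx_norm_leP m n (A : 'M[R]_(m, n)) (K : R) :
  0 <= K -> (forall i j, `|A i j| <= K) -> `|A| <= K.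
Proof.
by move=> K0 AK; rewrite [leLHS]/Num.norm /= mx_normrE bigmax_le.
Qed.

Lemma mulmx_norm_le m n p (A : 'M[R]_(m, n)) (B : 'M[R]_(n, p)) :
  `|A *m B| <= n%:R * `|A| * `|B|.
Proof.
apply: mx_norm_leP => [|i j]; first by rewrite !mulr_ge0.
rewrite mxE (le_trans (ler_norm_sum _ _ _))//.
apply: (@le_trans _ _ (\sum_(k < n) `|A| * `|B|)).
  by apply: ler_sum => k _; rewrite normrM ler_pM// mx_entry_le.
by rewrite sumr_const card_ord -[leLHS]mulr_natl mulrA.
Qed.

Lemma cvg_mxP {T : Type} (F : set_system T) {FF : Filter F} m n
    (f : T -> 'M[R]_(m, n)) (l : 'M[R]_(m, n)) :
  (f @ F --> l) <-> (forall i j, (fun x => f x i j) @ F --> l i j).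
Proof.
split=> [fl i j|fl]; apply/cvgrPdist_le => e e0.
  move/cvgrPdist_le : fl => /(_ e e0); apply: filterS => x; apply: le_trans.
  by have := mx_entry_le (l - f x) i j; rewrite !mxE.
near=> x; apply: mx_norm_leP (ltW e0) _ => i j; rewrite !mxE.
move: i j; near: x; apply: filter_forall => i; apply: filter_forall => j.
by have /cvgrPdist_le := fl i j; apply.
Unshelve. all: by end_near. Qed.

Lemma norm_trmx_le m k (A : 'M[R]_(m, k)) : `|A^T| <= `|A|.
Proof. by apply: mx_norm_leP => // i j; rewrite mxE mx_entry_le. Qed.

Lemma row_free_of_inj m k (A : 'M[R]_(m, k)) :
  (forall v : 'rV_m, v *m A = 0 -> v = 0) -> row_free A.
Proof.
by move=> inj; rewrite -kermx_eq0; apply/rowV0P => v /sub_kermxP; exact: inj.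
Qed.

Lemma cvg_bigsum {T : Type} (F : set_system T) {FF : Filter F}
    {V : normedModType R} (I : Type) (r : seq I) (f : I -> T -> V) (l : I -> V) :
  (forall i, f i @ F --> l i) ->
  (fun x => \sum_(i <- r) f i x) @ F --> \sum_(i <- r) l i.
Proof.
move=> fl; elim: r => [|i r IH].
  by rewrite big_nil; under eq_fun do rewrite big_nil; apply: cvg_cst.
by rewrite big_cons; under eq_fun do rewrite big_cons; apply: cvgD.
Qed.

Lemma cvg_mulmx {T : Type} (F : set_system T) {FF : Filter F} m n p
    (f : T -> 'M[R]_(m, n)) (g : T -> 'M[R]_(n, p))
    (a : 'M[R]_(m, n)) (b : 'M[R]_(n, p)) :
  f @ F --> a -> g @ F --> b -> (fun x => f x *m g x) @ F --> a *m b.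
Proof.
move=> /cvg_mxP fa /cvg_mxP gb; apply/cvg_mxP => i j.
rewrite mxE; under eq_fun do rewrite mxE.
by apply: cvg_bigsum => k; apply: cvgM.
Qed.

Lemma cvg_trmx {T : Type} (F : set_system T) {FF : Filter F} m k
    (A : T -> 'M[R]_(m, k)) (l : 'M[R]_(m, k)) :
  A @ F --> l -> (fun x => (A x)^T) @ F --> l^T.
Proof.
move=> /cvg_mxP Al; apply/cvg_mxP => i j; rewrite mxE.
by under eq_fun do rewrite mxE; exact: Al.
Qed.

Lemma near_norm_le m k (T : topologicalType) (A : T -> 'M[R]_(m, k)) (x : T) :
  A @ x --> A x -> \forall y \near x, `|A y| <= `|A x| + 1.
Proof.
move=> /cvgrPdist_le/(_ 1 ltr01); apply: filterS => y; rewrite distrC => H.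
by rewrite -[A y](subrKC (A x)) (le_trans (ler_normD _ _))// lerD.
Qed.

Lemma is_derive_mxP {V : normedModType R} m n (f : V -> 'M[R]_(m, n)) t v
    (df : 'M[R]_(m, n)) :
  is_derive t v f df <->
  forall i j, is_derive t v (fun x => f x i j) (df i j).
Proof.
split=> [[fd <-] i j|H].
  split; first exact: (derivable_mxP f t v).1 fd i j.
  by rewrite derive_mx // mxE.
have fd : derivable f t v by apply/derivable_mxP => i j; case: (H i j).
split => //; rewrite derive_mx//; apply/matrixP => i j; rewrite mxE.
by case: (H i j).
Qed.

Lemma is_derive_big {V W : normedModType R} (I : Type) (r : seq I)
    (f : I -> V -> W) (df : I -> W) t v :
  (forall i, is_derive t v (f i) (df i)) ->
  is_derive t v (fun x => \sum_(i <- r) f i x) (\sum_(i <- r) df i).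
Proof.
move=> fdf; elim: r => [|i r IH].
  rewrite big_nil (_ : (fun _ => _) = cst 0); first exact: is_derive_cst.
  by apply/funext => x; rewrite big_nil.
rewrite big_cons.
rewrite (_ : (fun _ => _) = f i + (fun x => \sum_(i <- r) f i x)).
  exact: is_deriveD.
by apply/funext => x; rewrite big_cons.
Qed.

Lemma derivable_prodr {V : normedModType R} (I : Type) (r : seq I)
    (f : I -> V -> R) t v : (forall i, derivable (f i) t v) ->
  derivable (fun x => \prod_(i <- r) f i x) t v.
Proof.
move=> fd; elim: r => [|i r IH].
  rewrite (_ : (fun _ => _) = cst 1); first exact: derivable_cst.
  by apply/funext => x; rewrite big_nil.
rewrite (_ : (fun _ => _) = f i * (fun x => \prod_(i <- r) f i x)).
  exact: derivableM.
by apply/funext => x; rewrite big_cons.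
Qed.

Lemma is_derive_mulmx {V : normedModType R} m n p (A : V -> 'M[R]_(m, n))
    (B : V -> 'M[R]_(n, p)) t v dA dB :
  is_derive t v A dA -> is_derive t v B dB ->
  is_derive t v (fun x => A x *m B x) (dA *m B t + A t *m dB).
Proof.
move=> /is_derive_mxP hA /is_derive_mxP hB; apply/is_derive_mxP => i j.
rewrite (_ : (fun _ => _) =
  fun x => \sum_k ((fun x => A x i k) * (fun x => B x k j)) x); last first.
  by apply/funext => x; rewrite mxE.
apply: is_derive_eq.
  by apply: is_derive_big => k; apply: is_deriveM.
rewrite !mxE -big_split; apply: eq_bigr => k _ /=.
by rewrite addrC; congr (_ + _); exact: mulrC.
Qed.

Lemma is_derive_trmx {V : normedModType R} m n (A : V -> 'M[R]_(m, n)) t v dA :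
  is_derive t v A dA -> is_derive t v (fun x => (A x)^T) dA^T.
Proof.
move=> /is_derive_mxP hA; apply/is_derive_mxP => i j; rewrite mxE.
by rewrite (_ : (fun _ => _) = fun x => A x j i)//; apply/funext => x; rewrite mxE.
Qed.

Lemma is_derive_col_mx {V : normedModType R} m1 m2 k (A : V -> 'M[R]_(m1, k))
    (B : V -> 'M[R]_(m2, k)) t v dA dB :
  is_derive t v A dA -> is_derive t v B dB ->
  is_derive t v (fun x => col_mx (A x) (B x)) (col_mx dA dB).
Proof.
move=> /is_derive_mxP hA /is_derive_mxP hB; apply/is_derive_mxP => i j.
rewrite mxE; under eq_fun do rewrite mxE.
by case: (fintype.split i) => l; [exact: hA|exact: hB].
Qed.

Lemma is_derive_row_mx {V : normedModType R} m k1 k2 (A : V -> 'M[R]_(m, k1))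
    (B : V -> 'M[R]_(m, k2)) t v dA dB :
  is_derive t v A dA -> is_derive t v B dB ->
  is_derive t v (fun x => row_mx (A x) (B x)) (row_mx dA dB).
Proof.
move=> /is_derive_mxP hA /is_derive_mxP hB; apply/is_derive_mxP => i j.
rewrite mxE; under eq_fun do rewrite mxE.
by case: (fintype.split j) => l; [exact: hA|exact: hB].
Qed.

Lemma derivable_det {V : normedModType R} n (A : V -> 'M[R]_n) t v :
  (forall i j, derivable (fun x => A x i j) t v) ->
  derivable (fun x => \det (A x)) t v.
Proof.
move=> hA; rewrite /determinant.
have H (s : 'S_n) : is_derive t v
    (fun x => (-1) ^+ s * \prod_i A x i (s i))
    ('D_v (fun x => (-1) ^+ s * \prod_i A x i (s i)) t).
  apply: derivableP; apply: (@derivableZ _ _ _ (fun x => \prod_i A x i (s i))).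
  exact: derivable_prodr.
by have [] := is_derive_big (index_enum _) H.
Qed.

(** Cramer's formula gives differentiability; the value of the derivative then
    follows from the product rule applied to [invmx (A x) *m A x = 1]. *)
Lemma is_derive_invmx {V : normedModType R} n (A : V -> 'M[R]_n) t v dA :
  (\forall x \near t, A x \in unitmx) -> is_derive t v A dA ->
  is_derive t v (fun x => invmx (A x)) (- (invmx (A t) *m dA *m invmx (A t))).
Proof.
move=> uA hA; have uAt := nbhs_singleton uA.
have dAij i j : derivable (fun x => A x i j) t v.
  by move/is_derive_mxP : hA => /(_ i j)[].
have dinv : derivable (fun x => invmx (A x)) t v.
  apply: (@near_eq_derivable _ _ _ (fun x => (\det (A x))^-1 *: \adj (A x))).
    by near do rewrite /invmx ifT//.
  apply/derivable_mxP => i j; under eq_fun do rewrite !mxE.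
  apply: derivableM.
    apply: derivableV; last exact: derivable_det.
    by move: uAt; rewrite unitmxE unitfE.
  rewrite /cofactor.
  apply: (@derivableZ _ _ _ (fun x => \det (row' j (col' i (A x))))).
  by apply: derivable_det => k l; under eq_fun do rewrite !mxE; exact: dAij.
have hinv := derivableP dinv.
have : is_derive t v (fun x => invmx (A x) *m A x) 0.
  apply: near_eq_is_derive (is_derive_cst (1%:M : 'M[R]_n) t v).
  by near do rewrite mulVmx//.
move=> [_ e1]; have [_] := is_derive_mulmx hinv hA; rewrite e1 => /esym e2.
apply: is_derive_eq hinv _; move/eqP: e2; rewrite addr_eq0 => /eqP e2.
by rewrite -(mulmxK uAt ('D_v _ t)) e2 mulNmx.
Unshelve. all: by end_near. Qed.

(** The mean value theorem, applied to each entry: the norm is the sup norm. *)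
Lemma norm_le_derive m n (f df : R -> 'M[R]_(m, n)) (a b K : R) : a <= b ->
  (forall t, a <= t <= b -> is_derive t 1 f (df t)) ->
  (forall t, a <= t <= b -> `|df t| <= K) ->
  `|f b - f a| <= K * (b - a).
Proof.
move=> ab fdf dfK.
have K0 : 0 <= K by rewrite (le_trans _ (dfK a _)) ?lexx.
apply: mx_norm_leP => [|i j]; first by rewrite mulr_ge0 // subr_ge0.
have fij t : a <= t <= b -> is_derive t 1 (fun x => f x i j) (df t i j).
  by move=> /fdf/is_derive_mxP.
have [||c cab E] := @MVT_segment R (fun x => f x i j) (fun t => df t i j) a b ab.
- by move=> x; rewrite in_itv /= => /andP[? ?]; apply: fij; rewrite !ltW.
- by apply: derivable_within_continuous => x; rewrite in_itv /= => /fij[+ _].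
rewrite !mxE E normrM (ger0_norm (_ : 0 <= b - a)) ?subr_ge0//.
rewrite ler_wpM2r ?subr_ge0//.
by apply: le_trans (mx_entry_le _ _ _) (dfK _ _); rewrite in_itv in cab.
Qed.

Lemma constant_of_derive0 m n (f : R -> 'M[R]_(m, n)) (I : set R) :
  is_interval I -> (forall t, I t -> is_derive t 1 f 0) ->
  forall s t, I s -> I t -> f s = f t.
Proof.
move=> itvI f0.
suff W s t : s <= t -> I s -> I t -> f s = f t.
  by move=> s t Is It; case: (leP s t) => [|/ltW] /W; [apply|move/(_ It Is)].
move=> st Is It; apply/esym/eqP; rewrite -subr_eq0 -normr_le0.
rewrite -[leRHS](mul0r (t - s)).
apply: (@norm_le_derive _ _ _ (fun=> 0)) => // x stx; last by rewrite normr0.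
by apply: f0; apply: (itvI s t).
Qed.

End MatrixNorm.

(** * Curves and their derivatives *)

Section Calculus.
Context {R : realType}.

(** A Lipschitz curve satisfies the Cauchy criterion at the end of its interval of
    definition. *)
Lemma cvg_at_left_of_bounded_derive m n (f df : R -> 'M[R]_(m, n)) (a b K : R) :
  a < b ->
  (forall t, a <= t < b -> is_derive t 1 f (df t)) ->
  (forall t, a <= t < b -> `|df t| <= K) ->
  exists l : 'M[R]_(m, n), f @ b^'- --> l.
Proof.
move=> ab fdf dfK.
have K0 : 0 <= K by rewrite (le_trans _ (dfK a _)) ?lexx.
suff : cvg (f @ b^'-) by move=> /cvg_ex.
apply: cauchy_cvg; apply: cauchy_exP => e e0.
pose s := Num.max a (b - e / (2 * (K + 1))).
have sb : s < b.
  by rewrite gt_max ab ltrBlDr ltrDl divr_gt0// mulr_gt0// ltr_wpDl.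
(* within distance [e / (2 * (K + 1))] of [b], the curve varies by less than [e] *)
exists (f s) => /=; near=> t.
have st : s <= t by apply: ltW; near: t; exact: nbhs_left_gt.
have tb : t < b by near: t; exact: nbhs_left_lt.
have as_ : a <= s by rewrite le_max lexx.
rewrite -ball_normE /= distrC.
apply: (@le_lt_trans _ _ (K * (t - s))).
  apply: (@norm_le_derive _ _ _ _ df) => // x /andP[sx xt].
    by apply: fdf; rewrite (le_trans as_ sx) (le_lt_trans xt).
  by apply: dfK; rewrite (le_trans as_ sx) (le_lt_trans xt).
have sbe : b - e / (2 * (K + 1)) <= s by rewrite le_max lexx orbT.
apply: (@le_lt_trans _ _ (K * (e / (2 * (K + 1))))).
  by rewrite ler_wpM2l//; lra.
rewrite mulrA ltr_pdivrMr; last by rewrite mulr_gt0// ltr_wpDl.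
have : 0 <= K * e by rewrite mulr_ge0 // ltW.
by nra.
Unshelve. all: by end_near. Qed.

(** No differentiability is assumed at [b] itself: by the mean value theorem,
    the difference quotients at [b] are values of the derivative nearby. *)
Lemma is_derive_of_continuous m n (f df : R -> 'M[R]_(m, n)) (b : R) :
  {for b, continuous f} -> {for b, continuous df} ->
  (\forall t \near b, t != b -> is_derive t 1 f (df t)) ->
  is_derive b 1 f (df b).
Proof.
move=> /cvg_mxP fc /cvg_mxP dfc near_df; apply/is_derive_mxP => i j.
pose F x := f x i j; pose D x := df x i j.
suff C : (fun h => h^-1 *: ((F \o shift b) (h *: 1) - F b)) @ 0^' --> D b.
  by split; [apply/cvg_ex; exists (D b) | exact: cvg_lim].
apply/cvgrPdist_le => e e0.
have /cvgrPdist_le/(_ e e0) De := dfc i j.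
have : \forall t \near b, `|D b - D t| <= e /\ (t != b -> is_derive t 1 F (D t)).
  near=> t; split; first by near: t.
  have : t != b -> is_derive t 1 f (df t) by near: t.
  by move=> H /H/is_derive_mxP; exact.
move=> /nbhs_ballP[d /= d0 dH].
have FC x : `|b - x| < d -> {for x, continuous F}.
  move=> bx; have [->|xb] := eqVneq x b; first exact: fc.
  have [_ /(_ xb)[Fx _]] := dH x bx.
  by apply: differentiable_continuous; apply/derivable1_diffP.
have mvt s t : s < t -> s = b \/ t = b -> `|s - t| < d ->
    exists c, `|b - c| < d /\ F t - F s = D c * (t - s).
  move=> st sbt std.
  have inb x : s <= x <= t -> `|b - x| < d.
    move=> /andP[sx xt]; apply: (le_lt_trans _ std).
    rewrite distrC (distrC s) (ger0_norm (_ : 0 <= t - s)); last by rewrite subr_ge0 ltW.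
    by case: sbt => E; rewrite ler_norml; apply/andP; split; lra.
  have [||c cst E] := @MVT R F D s t st.
  - move=> x; rewrite in_itv /= => /andP[sx xt].
    have [|_] := dH x; first by apply: inb; rewrite !ltW.
    apply; case: sbt => <-; [by rewrite gt_eqF|by rewrite lt_eqF].
  - apply: continuous_in_subspaceT => x; rewrite inE /= in_itv /= => xst.
    by apply: FC; exact: inb.
  exists c; split => //; apply: inb.
  by move: cst; rewrite in_itv /= => /andP[? ?]; rewrite !ltW.
near=> h.
have h0 : h != 0 by near: h; exact: nbhs_dnbhs_neq.
have hd : `|h| < d by near: h; exact: dnbhs0_lt.
rewrite /= /shift /= scaler1.
have [c [bc ->]] : exists c, `|b - c| < d /\ F (h + b) - F b = D c * h.
  move: h0; rewrite neq_lt => /orP[h0|h0].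
  - have [|||c [bc E]] := mvt (h + b) b; first by rewrite gtrDr.
    + by right.
    + by rewrite addrK.
    + by exists c; split => //; apply: oppr_inj; rewrite opprB E; ring.
  - have [|||c [bc E]] := mvt b (h + b); first by rewrite ltrDr.
    + by left.
    + by rewrite distrC addrK.
    + by exists c; split => //; rewrite E addrK.
have [Dc _] := dH c bc.
by rewrite /GRing.scale /= mulrC mulfK.
Unshelve. all: by end_near. Qed.

Lemma is_derive_continuous {V : normedModType R} (u : R -> V)
    (t : R) (du : V) : is_derive t 1 u du -> u @ t --> u t.
Proof. by case=> /derivable1_diffP/differentiable_continuous. Qed.

Lemma derive_comp {U V W : normedModType R} (h : U -> V)
    (k : V -> W) (x v : U) :
  differentiable h x -> differentiable k (h x) ->
  'D_v (k \o h) x = 'd k (h x) ('d h x v).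
Proof.
move=> hd kd; transitivity ('d (k \o h) x v).
  exact: (deriveE v (differentiable_comp hd kd)).
by have -> := diff_comp hd kd.
Qed.

Lemma is_derive_comp_diff {V W : normedModType R} (f : V -> W) (u : R -> V)
    (t : R) (du : V) :
  is_derive t 1 u du -> differentiable f (u t) ->
  is_derive t 1 (f \o u) ('d f (u t) du).
Proof.
move=> [ud <-] fd; have {}ud : differentiable u t by apply/derivable1_diffP.
have fu : differentiable (f \o u) t by exact: differentiable_comp.
split; first by apply/derivable1_diffP.
by rewrite !deriveE // diff_comp.
Qed.

(** The derivative of the Jacobian matrix of [phi] along a curve: its rows are
    the mixed second derivatives of [phi]. *)
Lemma is_derive_jacobian n m (phi : 'rV[R]_n -> 'rV[R]_m) (U : set 'rV[R]_n)
    (u : R -> 'rV[R]_n) (t : R) (du : 'rV[R]_n) :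
  open U -> (forall x, U x -> differentiable phi x) ->
  (forall v x, U x -> differentiable (fun y => 'D_v phi y) x) ->
  U (u t) -> is_derive t 1 u du ->
  exists2 J', is_derive t 1 (fun s => 'J phi (u s)) J' &
    forall w, 'D_du (fun y => 'D_w phi y) (u t) = w *m J'.
Proof.
move=> oU d1 d2 Uut udu.
have uc : {for t, continuous u}.
  by apply: differentiable_continuous; apply/derivable1_diffP; case: udu.
have nearU : \forall x \near u t, U x by apply: open_nbhs_nbhs.
have d2j i (j : 'I_m) :
    differentiable (fun y => 'D_(delta_mx 0 i) phi y 0 j) (u t).
  apply: (@differentiable_comp _ _ _ _ (fun y => 'D_(delta_mx 0 i) phi y)
    (fun z : 'rV[R]_m => z 0 j)) => //; first exact: d2.
  exact: differentiable_coord.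
have JE x i j : U x -> 'J phi x i j = 'D_(delta_mx 0 i) phi x 0 j.
  by move=> Ux; rewrite deriveE ?mxE//; exact: d1.
pose J' : 'M[R]_(n, m) :=
  \matrix_(i, j) 'd (fun y => 'D_(delta_mx 0 i) phi y 0 j) (u t) du.
exists J'.
  apply/is_derive_mxP => i j; rewrite mxE.
  apply: (@near_eq_is_derive _ _ _ ((fun y => 'D_(delta_mx 0 i) phi y 0 j) \o u)).
    have : \forall s \near t, U (u s) by exact: uc.
    by apply: filterS => s Us; rewrite /= JE.
  exact: is_derive_comp_diff.
have J'd : is_derive (u t) du (fun y => 'J phi y) J'.
  apply/is_derive_mxP => i j; rewrite mxE.
  apply: (@near_eq_is_derive _ _ _ (fun y => 'D_(delta_mx 0 i) phi y 0 j)).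
    by apply: filterS nearU => x Ux; rewrite JE.
  by apply: DeriveDef; [exact: diff_derivable|rewrite deriveE].
move=> w; rewrite (@near_eq_derive _ _ _ _ (fun y => w *m 'J phi y)); last first.
  by apply: filterS nearU => x Ux; rewrite deriveEjacobian//; exact: d1.
have [_ ->] := is_derive_mulmx (is_derive_cst w (u t) du) J'd.
by rewrite mul0mx add0r.
Qed.

Lemma near_at_leftP (a b : R) (P : R -> Prop) : a < b ->
  (\forall t \near b^'-, P t) ->
  exists2 c, a <= c < b & forall t, c <= t < b -> P t.
Proof.
move=> ab [/= e e0 eP]; exists (Num.max a (b - e / 2)).
  by rewrite le_max lexx gt_max ab ltrBlDr ltrDl divr_gt0.
move=> t /andP[]; rewrite ge_max => /andP[at_ et] tb; apply: eP => //=.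
by rewrite ger0_norm ?subr_ge0 ?ltW//; lra.
Qed.

Lemma near_at_left (a b : R) (P : R -> Prop) : a < b ->
  (forall t, a <= t < b -> P t) -> \forall t \near b^'-, P t.
Proof.
move=> ab H; near=> t; apply: H; apply/andP; split.
  by apply: ltW; near: t; exact: nbhs_left_gt.
by near: t; exact: nbhs_left_lt.
Unshelve. all: by end_near. Qed.

Lemma cvg_glue (T : topologicalType) (f g : R -> T) (b : R) :
  f @ b^'- --> g b -> g @ b --> g b ->
  (fun t => if t < b then f t else g t) @ b --> g b.
Proof.
move=> fb gb; pose h t := if t < b then f t else g t.
have hb : h b = g b by rewrite /h ltxx.
suff : h @ b --> h b by rewrite hb.
apply/left_right_continuousP; rewrite hb; split.
  apply: (cvg_trans _ fb); apply: near_eq_cvg; near=> t.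
  by rewrite /h ifT//; near: t; exact: nbhs_left_lt.
have /left_right_continuousP[_ gb'] := gb.
apply: (cvg_trans _ gb'); apply: near_eq_cvg; near=> t.
by rewrite /h ifF//; apply: le_gtF; near: t; exact: nbhs_right_ge.
Unshelve. all: by end_near. Qed.

Lemma is_derive_shift_arg {V : normedModType R} (x : R -> V) (t b : R) dx :
  is_derive (t - b) (1 : R) x dx -> is_derive t (1 : R) (fun s => x (s - b)) dx.
Proof.
move=> hx.
have db : is_derive t (1 : R) (fun s : R => s - b) 1.
  rewrite -[X in is_derive _ _ _ X]subr0.
  exact: (is_deriveB (is_derive_id t (1 : R)) (is_derive_cst b t (1 : R))).
have xd : differentiable x (t - b) by apply/derivable1_diffP; case: hx.
apply: is_derive_eq; first exact: (is_derive_comp_diff db xd).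
by rewrite -deriveE//; case: hx.
Qed.

Lemma is_derive_opp_arg {V : normedModType R} (x : R -> V) (t : R) dx :
  is_derive (- t) (1 : R) x dx -> is_derive t (1 : R) (fun s => x (- s)) (- dx).
Proof.
move=> hx.
have db : is_derive t (1 : R) (fun s : R => - s) (-1).
  exact: (is_deriveN (is_derive_id t (1 : R))).
have xd : differentiable x (- t) by apply/derivable1_diffP; case: hx.
apply: is_derive_eq; first exact: (is_derive_comp_diff db xd).
by rewrite linearN /= -deriveE//; case: hx => _ ->.
Qed.

End Calculus.

(** * Existence of solutions of differential equations *)

Section Picard.
Context {R : realType}.

(** The interval of integration starts at [-1], so that the fundamental theorem of
    calculus applies on both sides of the initial time [0]. *)
Lemma antiderivative (g : R -> R) : continuous g ->
  exists G : R -> R,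
    G 0 = 0 /\ forall t : R, -1 < t < 1 -> is_derive t (1 : R) G (g t).
Proof.
move=> gc; pose F x : R := Rintegral lebesgue_measure `[-1, x]%classic g.
exists (fun x => F x - F 0); split => [|t /andP[t1 t2]]; first by rewrite subrr.
have ig : (@lebesgue_measure R).-integrable `[-1, 1]%classic (EFin \o g).
  apply: continuous_compact_integrable; first exact: segment_compact.
  exact: continuous_subspaceT.
have dF : derivable F t 1 /\ F^`()%classic t = g t.
  exact: (continuous_FTC1_closed t2 ig t1 (gc t)).
clearbody F; have {dF} : is_derive t (1 : R) F (g t).
  by case: dF => dF eF; split => //; rewrite -derive1E.
move=> dF; rewrite -[g t]subr0.
exact: (is_deriveB dF (is_derive_cst (F 0) t (1 : R))).
Qed.

Lemma antiderivative_row m (g : R -> 'rV[R]_m) : continuous g ->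
  exists G : R -> 'rV[R]_m,
    G 0 = 0 /\ forall t : R, -1 < t < 1 -> is_derive t (1 : R) G (g t).
Proof.
move=> gc.
have /choice[G HG] (i : 'I_m) : exists G : R -> R, G 0 = 0 /\
    forall t : R, -1 < t < 1 -> is_derive t (1 : R) G (g t 0 i).
  apply: (antiderivative (g := fun t => g t 0 i)) => t.
  by have /cvg_mxP := gc t; exact.
exists (fun t => \row_i G i t); split.
  by apply/rowP => i; rewrite !mxE; case: (HG i).
move=> t t1; apply/is_derive_mxP => i j; rewrite ord1.
rewrite (_ : (fun _ => _) = G j); last by apply/funext => x; rewrite mxE.
by case: (HG j) => _; exact.
Qed.

Definition clamp (a b x : R) : R := Num.max a (Num.min b x).

Lemma clamp_le (a b x : R) : a <= b -> a <= clamp a b x <= b.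
Proof. by move=> ab; rewrite /clamp le_max lexx ge_max ab ge_min lexx. Qed.

Lemma clamp_id (a b x : R) : a <= x <= b -> clamp a b x = x.
Proof. by move=> /andP[ax xb]; rewrite /clamp min_r// max_r. Qed.

Lemma clamp_lipschitz (a b x y : R) : a <= b ->
  `|clamp a b x - clamp a b y| <= `|x - y|.
Proof.
move=> ab; wlog xy : x y / x <= y.
  by move=> W; case: (leP x y) => [|/ltW] /W//; rewrite distrC (distrC y).
rewrite distrC (distrC x) (ger0_norm (_ : 0 <= y - x)) ?subr_ge0//.
rewrite /clamp; case: (leP b x) => bx; case: (leP b y) => by_;
  rewrite ?(max_r ab); try (case: (leP a x) => ax); try (case: (leP a y) => ay);
  rewrite ler_norml; apply/andP; split; lra.
Qed.

Lemma continuous_of_lipschitz {V W : normedModType R} (f : V -> W) (L : R) :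
  (forall x y, `|f x - f y| <= L * `|x - y|) -> continuous f.
Proof.
move=> fL x; have L1 : 0 < `|L| + 1 by rewrite ltr_wpDl.
apply/cvgrPdist_le => e e0; near=> y.
apply: le_trans (fL _ _) _.
apply: (@le_trans _ _ ((`|L| + 1) * `|x - y|)).
  by rewrite ler_wpM2r// ler_wpDr// ler_norm.
rewrite -ler_pdivlMl// mulrC; near: y.
have /cvgrPdist_le := @cvg_id _ (nbhs x); apply.
by rewrite divr_gt0.
Unshelve. all: by end_near. Qed.

Lemma geometric_small (C e : R) : 0 < e -> exists k, C * 2^-1 ^+ k <= e.
Proof.
move=> e0.
have : (fun k => C * (2^-1 : R) ^+ k) @ \oo --> (0 : R).
  by apply: cvg_geometric; rewrite ger0_norm ?invr_ge0// invf_lt1// ltr1n.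
move=> /cvgrPdist_le /(_ e e0) [N _ /(_ N (leqnn N))].
by rewrite sub0r normrN => H; exists N; rewrite (le_trans (ler_norm _)).
Qed.

(** A sequence of functions whose increments are dominated by a geometric
    series converges uniformly. *)
Lemma uniform_limit m (T : Type) (u : nat -> T -> 'rV[R]_m) (C : R) : 0 <= C ->
  (forall k t, `|u k.+1 t - u k t| <= C * 2^-1 ^+ k) ->
  exists y, forall k t, `|y t - u k t| <= 2 * C * 2^-1 ^+ k.
Proof.
move=> C0 hu.
have hukm k l t : `|u (k + l)%N t - u k t| <= 2 * C * 2^-1 ^+ k * (1 - 2^-1 ^+ l).
  (* partial sums of the geometric series *)
  elim: l => [|l IH]; first by rewrite addn0 !subrr normr0 mulr0.
  rewrite addnS (le_trans (ler_distD (u (k + l)%N t) _ _))//.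
  apply: (le_trans (lerD (hu _ _) IH)).
  rewrite exprD exprS; set a := _ ^+ k; set b := _ ^+ l.
  by rewrite le_eqVlt; apply/orP; left; apply/eqP; field.
have p2 k : 0 <= (2^-1 : R) ^+ k by rewrite exprn_ge0// invr_ge0.
have hukn k n t : (k <= n)%N -> `|u n t - u k t| <= 2 * C * 2^-1 ^+ k.
  move=> kn; rewrite -(subnKC kn) (le_trans (hukm _ _ _))//.
  by rewrite ler_piMr ?mulr_ge0// gerBl.
have /choice[y hy] t : exists y : 'rV[R]_m, (u k t @[k --> \oo]) --> y.
  suff : cvg (u k t @[k --> \oo]) by move=> /cvg_ex.
  apply: cauchy_cvg; apply: cauchy_exP => e e0.
  have [k hk] : exists k, 2 * C * 2^-1 ^+ k <= e / 2.
    by apply: geometric_small; rewrite divr_gt0.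
  exists (u k t); exists k => // n /= kn; rewrite -ball_normE /= distrC.
  by rewrite (le_lt_trans (hukn _ _ _ kn))// (le_lt_trans hk)//; lra.
exists y => k t; apply/ler_addgt0Pr => e e0.
have /cvgrPdist_le/(_ e e0)[N _ hN] := hy t.
have H := hN (maxn N k) (leq_maxl _ _).
rewrite (le_trans (ler_distD (u (maxn N k) t) _ _))// addrC.
by rewrite lerD// hukn// leq_maxr.
Qed.

(** Picard's iteration, on a time interval short enough for the integral
    operator to be a contraction of ratio 1/2 in the sup norm. *)
Lemma picard_lipschitz m (Phi : 'rV[R]_m -> 'rV[R]_m) (L : R) (y0 : 'rV[R]_m) :
  0 <= L -> (forall y z, `|Phi y - Phi z| <= L * `|y - z|) ->
  exists2 e : R, 0 < e & exists y : R -> 'rV[R]_m,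
    y 0 = y0 /\ forall t : R, `|t| < e -> is_derive t 1 y (Phi (y t)).
Proof.
move=> L0 PhiL; pose e : R := (2 * (L + 1))^-1.
have L1 : 0 < 2 * (L + 1) by rewrite mulr_gt0// ltr_wpDl.
have e0 : 0 < e by rewrite invr_gt0.
have eL : L * e <= 2^-1.
  by rewrite /e invfM mulrCA ler_piMr// ler_pdivrMr ?ltr_wpDl// mul1r lerDl.
have e1 : e < 1 by rewrite invf_lt1//; lra.
have ee : - e <= e by lra.
pose c := clamp (- e) e.
have cle t : `|c t| <= e by rewrite ler_norml clamp_le.
have Phic : continuous Phi := continuous_of_lipschitz PhiL.
(* [G y] is the primitive of [Phi \o y] that vanishes at [0] *)
have /choice[G HG] (y : R -> 'rV[R]_m) : exists G : R -> 'rV[R]_m,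
    continuous y -> G 0 = 0 /\
    forall t : R, -1 < t < 1 -> is_derive t (1 : R) G (Phi (y t)).
  have [yc|nyc] := pselect (continuous y); last by exists 0.
  have [|G HG] := @antiderivative_row m (Phi \o y); last by exists G.
  by move=> t; apply: continuous_comp; [exact: yc|exact: Phic].
have t1 t : `|t| <= e -> -1 < t < 1.
  by rewrite ler_norml => /andP[? ?]; apply/andP; split; lra.
pose P y t := y0 + G y (c t).
have cc : continuous c.
  apply: (@continuous_of_lipschitz _ _ _ 1) => x y.
  by rewrite mul1r; exact: clamp_lipschitz.
have Pc y : continuous y -> continuous (P y).
  move=> yc t; apply: cvgD; first exact: cvg_cst.
  apply: (continuous_comp (f := c) (g := G y)); first exact: cc.
  have [_ /(_ (c t) (t1 _ (cle t)))[dG _]] := HG y yc.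
  by apply: differentiable_continuous; apply/derivable1_diffP.
have Plip y z D : continuous y -> continuous z -> 0 <= D ->
    (forall t, `|y t - z t| <= D) -> forall t, `|P y t - P z t| <= D / 2.
  move=> yc zc D0 yzD t; have [Gy0 dGy] := HG y yc; have [Gz0 dGz] := HG z zc.
  have dGyz (s : R) : `|s| <= e -> is_derive s (1 : R) (G y - G z) (Phi (y s) - Phi (z s)).
    by move=> /t1 s1; apply: is_deriveB; [exact: dGy|exact: dGz].
  have Gyz0 : (G y - G z) 0 = 0 by rewrite !fctE Gy0 Gz0 subrr.
  have bnd s : `|Phi (y s) - Phi (z s)| <= L * D.
    by rewrite (le_trans (PhiL _ _))// ler_wpM2l.
  have LDe : L * D * e <= D / 2 by rewrite mulrAC mulrC ler_wpM2l.
  have LD0 : 0 <= L * D by rewrite mulr_ge0.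
  have -> : P y t - P z t = (G y - G z) (c t).
    by rewrite /P opprD addrACA subrr add0r.
  have := cle t; move: (c t) => s se.
  have [s0|s0] := leP 0 s.
    have := @norm_le_derive _ _ _ (G y - G z) _ 0 s _ s0 _ (fun x _ => bnd x).
    rewrite Gyz0 !subr0 => H; apply: (le_trans (H _)).
      move=> x /andP[? ?]; apply: dGyz; move: se; rewrite !ger0_norm//.
      by apply: le_trans.
    by apply: (le_trans _ LDe); rewrite ler_wpM2l//; move: se; rewrite ger0_norm.
  have := @norm_le_derive _ _ _ (G y - G z) _ s 0 _ (ltW s0) _ (fun x _ => bnd x).
  rewrite Gyz0 !sub0r normrN => H; apply: (le_trans (H _)).
    move=> x /andP[? ?]; apply: dGyz; move: se.
    by rewrite (ltr0_norm s0) ler0_norm// => ?; lra.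
  by apply: (le_trans _ LDe); rewrite ler_wpM2l//; move: se; rewrite ltr0_norm.
(* [P] is the integral operator; clamping the time makes its values continuous
   on the whole line *)
have [u [u0 uS]] : exists u : nat -> R -> 'rV[R]_m,
    u 0 = cst y0 /\ forall k, u k.+1 = P (u k).
  by exists (fun k => iter k P (cst y0)).
have uc k : continuous (u k).
  elim: k => [|k IH]; first by rewrite u0; exact: cst_continuous.
  by rewrite uS; exact: Pc.
pose C := `|Phi y0|.
have C0 : 0 <= C by exact: normr_ge0.
have hu k t : `|u k.+1 t - u k t| <= C * 2^-1 ^+ k.
  elim: k t => [|k IH] t; last first.
    have D0 : 0 <= C * 2^-1 ^+ k by rewrite mulr_ge0.
    have := @Plip (u k.+1) (u k) _ (uc _) (uc _) D0 IH t.
    by rewrite -!uS exprSr mulrA.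
  rewrite expr0 mulr1 uS u0 /P /cst addrC addKr.
  have [G0 dG] := HG (cst y0) (@cst_continuous _ _ _).
  have := cle t; move: (c t) => s se.
  have [s0|s0] := leP 0 s.
    have := @norm_le_derive _ _ _ (G (cst y0)) (fun=> Phi y0) 0 s C s0.
    rewrite G0 !subr0 => H; apply: (le_trans (H _ _)) => //.
      move=> x /andP[? ?]; apply: dG; apply: t1; move: se; rewrite !ger0_norm//.
      by apply: le_trans.
    by rewrite ler_piMr//; move: se; rewrite ger0_norm//; lra.
  have := @norm_le_derive _ _ _ (G (cst y0)) (fun=> Phi y0) s 0 C (ltW s0).
  rewrite G0 !sub0r normrN => H; apply: (le_trans (H _ _)) => //.
    move=> x /andP[? ?]; apply: dG; apply: t1; move: se.
    by rewrite (ltr0_norm s0) ler0_norm// => ?; lra.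
  by rewrite ler_piMr//; move: se; rewrite ltr0_norm//; lra.
have [y hy] := uniform_limit (normr_ge0 _) hu.
have yc : continuous y.
  move=> t; apply/cvgrPdist_le => d d0.
  have [k hk] : exists k, 2 * C * 2^-1 ^+ k <= d / 3.
    by apply: geometric_small; rewrite divr_gt0.
  near=> s.
  have ts : `|u k t - u k s| <= d / 3.
    by near: s; have /cvgrPdist_le := uc k t; apply; rewrite divr_gt0.
  have := hy k t; have := hy k s; rewrite (distrC (y s)) => h1 h2.
  have := ler_distD (u k t) (y t) (y s).
  have := ler_distD (u k s) (u k t) (y s).
  by move: h1 h2 ts hk; rewrite -/C; lra.
have Py : P y = y.
  apply/funext => t; apply/eqP; rewrite -subr_eq0 -normr_le0.
  apply/ler_addgt0Pr => d d0; rewrite add0r.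
  have [k hk] := geometric_small (2 * C) d0.
  have D0 : 0 <= 2 * C * 2^-1 ^+ k.
    by rewrite !mulr_ge0.
  have h1 := @Plip y (u k) _ yc (uc k) D0 (hy k) t.
  have := hy k.+1 t; rewrite distrC exprSr mulrA => h2.
  have := ler_distD (u k.+1 t) (P y t) (y t).
  by move: h1 h2 hk; rewrite uS -/C; lra.
have [G0 dG] := HG y yc.
exists e => //; exists y; split.
  by rewrite -Py /P /c clamp_id ?G0 ?addr0//; apply/andP; split; lra.
move=> t te; rewrite -{1}Py.
apply: (@near_eq_is_derive _ _ _ (cst y0 + G y)); last first.
  rewrite -[Phi _]add0r; apply: is_deriveD.
  by apply: dG; apply: t1; exact: ltW.
near=> s; rewrite /P /c clamp_id// -ler_norml; apply: ltW.
by near: s; have /cvgr_lt := @norm_continuous _ _ t; apply.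
Unshelve. all: by end_near. Qed.

End Picard.

(** * Locally Lipschitz fields and perturbation of injective maps *)

Section LocalPicard.
Context {R : realType}.

Definition locally_lipschitz {V W : normedModType R} (f : V -> W) (x0 : V) :=
  exists L d : R, [/\ 0 <= L, 0 < d & forall x y,
    `|x - x0| <= d -> `|y - x0| <= d -> `|f x - f y| <= L * `|x - y|].

Section Operations.
Context {V : normedModType R}.

Lemma locally_lipschitzD {W : normedModType R} (f g : V -> W) x0 :
  locally_lipschitz f x0 -> locally_lipschitz g x0 ->
  locally_lipschitz (fun x : _ => f x + g x) x0.
Proof.
move=> [L [d [L0 d0 fL]]] [K [e [K0 e0 gK]]].
exists (L + K), (Num.min d e); split; rewrite ?addr_ge0 ?lt_min ?d0//.
move=> x y; rewrite !le_min => /andP[xd xe] /andP[yd ye].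
by rewrite opprD addrACA mulrDl (le_trans (ler_normD _ _))// lerD ?fL ?gK.
Qed.

Lemma locally_lipschitz_cst {W : normedModType R} (w : W) x0 :
  locally_lipschitz (fun _ : V => w) x0.
Proof. by exists 0, 1; split => // x y _ _; rewrite subrr normr0 mul0r. Qed.

Lemma locally_lipschitz_sum {W : normedModType R} (I : Type) (r : seq I)
    (f : I -> V -> W) x0 :
  (forall i, locally_lipschitz (f i) x0) ->
  locally_lipschitz (fun x : _ => \sum_(i <- r) f i x) x0.
Proof.
move=> fl; elim: r => [|i r IH].
  by under eq_fun do rewrite big_nil; exact: locally_lipschitz_cst.
by under eq_fun do rewrite big_cons; exact: locally_lipschitzD.
Qed.

Lemma locally_lipschitzZ {W : normedModType R} (f : V -> R) (g : V -> W) x0 :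
  locally_lipschitz f x0 -> locally_lipschitz g x0 ->
  locally_lipschitz (fun x : _ => f x *: g x) x0.
Proof.
move=> [L [d [L0 d0 fL]]] [K [e [K0 e0 gK]]].
pose Mf := `|f x0| + L * d; pose Mg := `|g x0| + K * e.
have Mf0 : 0 <= Mf by rewrite addr_ge0// mulr_ge0// ltW.
have Mg0 : 0 <= Mg by rewrite addr_ge0// mulr_ge0// ltW.
exists (Mf * K + Mg * L), (Num.min d e).
split; rewrite ?lt_min ?d0// ?addr_ge0// ?mulr_ge0//.
move=> x y; rewrite !le_min => /andP[xd xe] /andP[yd ye].
have fx : `|f x| <= Mf.
  rewrite -[f x](subrKC (f x0)) (le_trans (ler_normD _ _))// lerD//.
  by rewrite (le_trans (fL _ _ _ _)) ?subrr ?normr0 ?(ltW d0)// ler_wpM2l.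
have gy : `|g y| <= Mg.
  rewrite -[g y](subrKC (g x0)) (le_trans (ler_normD _ _))// lerD//.
  by rewrite (le_trans (gK _ _ _ _)) ?subrr ?normr0 ?(ltW e0)// ler_wpM2l.
have -> : f x *: g x - f y *: g y = f x *: (g x - g y) + (f x - f y) *: g y.
  by rewrite scalerBr scalerBl addrA subrK.
rewrite (le_trans (ler_normD _ _))// !normrZ mulrDl -!mulrA lerD//.
  by rewrite ler_pM// gK.
by rewrite [leRHS]mulrC ler_pM// fL.
Qed.

Lemma locally_lipschitz_mulmxr n m (f : V -> 'rV[R]_n) (A : 'M[R]_(n, m)) x0 :
  locally_lipschitz f x0 -> locally_lipschitz (fun x : _ => f x *m A) x0.
Proof.
move=> [L [d [L0 d0 fL]]]; exists (n%:R * `|A| * L), d.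
split => //; first by rewrite !mulr_ge0.
move=> x y xd yd; rewrite -mulmxBl (le_trans (mulmx_norm_le _ _))//.
by rewrite -[leRHS]mulrA mulrAC ler_wpM2l ?mulr_ge0 ?fL.
Qed.

End Operations.

Lemma locally_lipschitz_coord n (x0 : 'rV[R]_n) i :
  locally_lipschitz (fun x : 'rV[R]_n => x 0 i) x0.
Proof.
exists 1, 1; split => // x y _ _; rewrite mul1r.
by have := mx_entry_le (x - y) 0 i; rewrite !mxE.
Qed.

Lemma locally_lipschitz_id (V : normedModType R) (x0 : V) :
  locally_lipschitz id x0.
Proof. by exists 1, 1; split => // x y _ _; rewrite mul1r. Qed.

Lemma locally_lipschitz_comp_mulmx n m (W : normedModType R)
    (g : 'rV[R]_m -> W) (A : 'M[R]_(n, m)) (x0 : 'rV[R]_n) :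
  locally_lipschitz g (x0 *m A) -> locally_lipschitz (fun x : _ => g (x *m A)) x0.
Proof.
move=> [L [d [L0 d0 gL]]]; pose K := n%:R * `|A|.
have K0 : 0 <= K by rewrite mulr_ge0.
have AK (x y : 'rV[R]_n) : `|x *m A - y *m A| <= K * `|x - y|.
  by rewrite -mulmxBl (le_trans (mulmx_norm_le _ _))// mulrAC.
have K1 : 0 < K + 1 by rewrite ltr_wpDl.
exists (L * K), (d / (K + 1)); split; rewrite ?divr_gt0 ?mulr_ge0//.
have bnd x : `|x - x0| <= d / (K + 1) -> `|x *m A - x0 *m A| <= d.
  rewrite ler_pdivlMr// => xd; rewrite (le_trans (AK _ _))//.
  by apply: le_trans xd; rewrite mulrC ler_wpM2l// lerDl.
move=> x y /bnd xd /bnd yd.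
by rewrite (le_trans (gL _ _ xd yd))// -mulrA ler_wpM2l.
Qed.

(** A C^1 map is locally Lipschitz: mean value inequality along segments. *)
Lemma locally_lipschitz_C1 n m (f : 'rV[R]_n -> 'rV[R]_m) (U : set 'rV[R]_n)
    (x0 : 'rV[R]_n) :
  open U -> U x0 -> (forall x, U x -> differentiable f x) ->
  (forall v, {for x0, continuous (fun x => 'D_v f x)}) ->
  locally_lipschitz f x0.
Proof.
move=> oU Ux0 fd fc.
pose e_ (i : 'I_n) : 'rV[R]_n := delta_mx 0 i.
pose K := \sum_i (`|'D_(e_ i) f x0| + 1).
have : \forall x \near x0, U x /\ forall i,
    `|'D_(e_ i) f x| <= `|'D_(e_ i) f x0| + 1.
  near=> x; split; first by near: x; exact: open_nbhs_nbhs.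
  near: x; apply: filter_forall => i.
  have /cvgrPdist_le/(_ 1 ltr01) := fc (e_ i).
  apply: filterS => x; rewrite distrC => H.
  rewrite -['D_(e_ i) f x](subrKC ('D_(e_ i) f x0)).
  by rewrite (le_trans (ler_normD _ _))// lerD.
move=> /nbhs_ballP[d /= d0 dH].
have dfK x v : `|x0 - x| < d -> `|'d f x v| <= K * `|v|.
  move=> xd; have [|Ux DK] := dH x; first by rewrite -ball_normE.
  rewrite {1}(row_sum_delta v) linear_sum (le_trans (ler_norm_sum _ _ _))//.
  rewrite /K mulr_suml; apply: ler_sum => i _.
  rewrite linearZ normrZ mulrC ler_pM// ?mx_entry_le//.
  by rewrite -deriveE ?DK//; exact: fd.
exists K, (d / 2); split; rewrite ?divr_gt0//.
  by apply: sumr_ge0 => i _; rewrite addr_ge0.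
move=> x y xd yd; (* both points lie within [d / 2] of [x0], hence so does the segment [l] *)
pose l s := y + s *: (x - y).
have ld s : 0 <= s <= 1 -> `|x0 - l s| < d.
  move=> /andP[s0 s1]; have -> : x0 - l s = (1 - s) *: (x0 - y) + s *: (x0 - x).
    by rewrite /l; apply/rowP => i; rewrite !mxE; ring.
  rewrite (le_lt_trans (ler_normD _ _))// !normrZ.
  rewrite (ger0_norm s0) ger0_norm ?subr_ge0// (distrC x0 y) (distrC x0 x).
  have : 0 <= (1 - s) * (d / 2 - `|y - x0|) by rewrite mulr_ge0// subr_ge0.
  have : 0 <= s * (d / 2 - `|x - x0|) by rewrite mulr_ge0// subr_ge0.
  by lra.
have dl (s : R) : is_derive s (1 : R) l (x - y).
  rewrite -[x - y]add0r; apply: (@is_deriveD _ _ _ (cst y)).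
  apply/is_derive_mxP => i j; rewrite !mxE.
  rewrite (_ : (fun _ => _) = (x - y) i j \*: id).
    by apply: is_derive_eq; rewrite !mxE /GRing.scale /= mulr1.
  by apply/funext => z; rewrite /= mxE mulrC.
have l1 : l 1 = x by rewrite /l scale1r subrKC.
have l0 : l 0 = y by rewrite /l scale0r addr0.
have := @norm_le_derive _ _ _ (f \o l) (fun s => 'd f (l s) (x - y)) 0 1
  (K * `|x - y|) ler01.
rewrite subr0 mulr1 /= l1 l0; apply => t t01.
  apply: is_derive_comp_diff => //; apply: fd.
  by have [] := dH (l t); rewrite // -ball_normE; exact: ld.
by apply: dfK; exact: ld.
Unshelve. all: by end_near. Qed.

(** Picard's theorem for a locally Lipschitz field: compose the field with the
    retraction onto a closed sup-norm ball, which acts coordinatewise. *)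
Theorem picard m (Phi : 'rV[R]_m -> 'rV[R]_m) (y0 : 'rV[R]_m) :
  locally_lipschitz Phi y0 ->
  exists2 e : R, 0 < e & exists y : R -> 'rV[R]_m,
    y 0 = y0 /\ forall t : R, `|t| < e -> is_derive t 1 y (Phi (y t)).
Proof.
move=> [L [d [L0 d0 PhiL]]].
pose r (x : 'rV[R]_m) := \row_i clamp (y0 0 i - d) (y0 0 i + d) (x 0 i).
have yd i : y0 0 i - d <= y0 0 i + d by lra.
have rd x : `|r x - y0| <= d.
  apply: mx_norm_leP => [|i j]; first exact: ltW.
  rewrite !mxE ord1; have := clamp_le (x 0 j) (yd j) => /andP[? ?].
  by rewrite ler_norml; apply/andP; split; lra.
have rL x y : `|r x - r y| <= `|x - y|.
  apply: mx_norm_leP => // i j; rewrite !mxE.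
  apply: le_trans (clamp_lipschitz _ _ (yd j)) _.
  by have := mx_entry_le (x - y) 0 j; rewrite !mxE.
have rid x : `|x - y0| <= d -> r x = x.
  move=> xd; apply/rowP => i; rewrite mxE clamp_id//.
  have := le_trans (mx_entry_le (x - y0) 0 i) xd; rewrite !mxE ler_norml.
  by move=> /andP[? ?]; apply/andP; split; lra.
have [|e e0 [y [y0E dy]]] := @picard_lipschitz _ _ (Phi \o r) L y0 L0.
  move=> x y; rewrite /= (le_trans (PhiL _ _ (rd _) (rd _)))//.
  by rewrite ler_wpM2l.
have yc : y @ (0 : R) --> y0.
  rewrite -y0E; apply: differentiable_continuous; apply/derivable1_diffP.
  by have [] := dy 0; rewrite ?normr0.
have : \forall t \near (0 : R), `|y t - y0| <= d.
  move/cvgrPdist_le : yc => /(_ d d0).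
  by apply: filterS => t; rewrite distrC.
move=> /nbhs_ballP[e1 /= e10 He1].
exists (Num.min e e1); first by rewrite lt_min e0.
exists y; split => // t; rewrite lt_min => /andP[te te1].
have := dy t te; rewrite /= rid//; apply: He1.
by rewrite -ball_normE /= sub0r normrN.
Qed.

(** Injectivity of a linear map persists, with a uniform lower bound, under
    small perturbations. *)
Lemma row_free_lower_bound (T : Type) (F : set_system T) {FF : Filter F} n k
    (A : T -> 'M[R]_(n, k)) (A0 : 'M[R]_(n, k)) :
  A @ F --> A0 -> row_free A0 ->
  exists2 K, 0 <= K & \forall x \near F, forall v : 'rV[R]_n,
    `|v| <= K * `|v *m A x|.
Proof.
move=> AA0 fA0; pose C := k%:R * `|pinvmx A0|.
have C0 : 0 <= C by rewrite mulr_ge0.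
have vC (v : 'rV[R]_n) : `|v| <= C * `|v *m A0|.
  rewrite -{1}[v]mulmx1 -(mulmxVp fA0) mulmxA.
  by rewrite (le_trans (mulmx_norm_le _ _))// mulrAC.
(* a perturbation of [A0] of this size costs at most half of [`|v|] *)
have e0 : 0 < (2 * (C + 1) * (n%:R + 1))^-1 :> R.
  by rewrite invr_gt0 !mulr_gt0// ltr_wpDl.
exists (2 * C); first by rewrite mulr_ge0.
move/cvgrPdist_le : AA0 => /(_ _ e0); apply: filterS => x Ax v.
have h1 : `|v *m A0| <= `|v *m A x| + `|v *m (A0 - A x)|.
  by rewrite -{1}(subrKC (A x) A0) mulmxDr ler_normD.
have h2 := mulmx_norm_le v (A0 - A x).
have h3 : C * (n%:R * `|v| * `|A0 - A x|) <= `|v| / 2.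
  have -> : C * (n%:R * `|v| * `|A0 - A x|) = `|v| * (C * n%:R * `|A0 - A x|).
    by ring.
  rewrite ler_wpM2l//.
  apply: (@le_trans _ _ ((C + 1) * (n%:R + 1) * (2 * (C + 1) * (n%:R + 1))^-1)).
    by rewrite !ler_pM ?mulr_ge0// lerDl.
  by rewrite le_eqVlt; apply/orP; left; apply/eqP; field;
    rewrite !gt_eqF// ltr_wpDl.
have h4 : C * `|v *m A0| <= C * `|v *m A x| + `|v| / 2.
  apply: le_trans (lerD (lexx _) h3); rewrite -mulrDr ler_wpM2l//.
  by rewrite (le_trans h1)// lerD.
by have := vC v; lra.
Qed.

End LocalPicard.

(** * Charts and smooth maps *)

Section Charts.
Context {R : realType} {n : nat} {M : smooth_manifold R n}.
Implicit Types (c d : chart R n M).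

Lemma img_coord c p : dom c p -> img c (coord c p).
Proof. by move=> cp; exists p. Qed.

Lemma img_open c : open (img c).
Proof. exact: coord_dom_open. Qed.

Lemma overlap_open c d : open (overlap c d).
Proof.
rewrite openE => x [cx dx]; apply: filterI.
  by apply: open_nbhs_nbhs; split => //; exact: coord_dom_open.
apply: (param_continuous cx); apply: open_nbhs_nbhs; split => //.
exact: dom_open.
Qed.

Section Smooth.
Context {V W : normedModType R} (U : set V) (f : V -> W).
Hypothesis fs : smooth_on U f.

Lemma smooth_differentiable x : U x -> differentiable f x.
Proof. by move=> Ux; have [+ _] := fs 1; apply. Qed.

Lemma smooth_derive_differentiable v x : U x -> differentiable ('D_v f) x.
Proof. by move=> Ux; have [_ /(_ v)[+ _]] := fs 2; apply. Qed.

Lemma smooth_derive_continuous v x : U x -> {for x, continuous ('D_v f)}.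
Proof.
by move=> Ux; apply: differentiable_continuous;
  exact: smooth_derive_differentiable.
Qed.

End Smooth.

Lemma smooth_cst (V W : normedModType R) (U : set V) (w : W) :
  smooth_on U (fun=> w).
Proof.
move=> k; elim: k w => [|k IH] w /=.
  by move=> x _; exact: cst_continuous.
split=> [x _|v]; first exact: differentiable_cst.
have -> : (fun x => 'D_v (fun=> w) x) = fun=> 0; last exact: IH.
by apply/funext => x; rewrite derive_cst.
Qed.

Lemma jacobian_continuous (m p : nat) (U : set 'rV[R]_m)
    (phi : 'rV[R]_m -> 'rV[R]_p) (x : 'rV[R]_m) : open U -> smooth_on U phi -> U x ->
  {for x, continuous (fun z => 'J phi z)}.
Proof.
move=> oU sphi Ux; apply/(@cvg_mxP R _ (nbhs x) _ m p (fun z => 'J phi z) ('J phi x)) => i j.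
have JE z : U z -> 'J phi z i j = 'D_(delta_mx 0 i) phi z 0 j.
  by move=> Uz; rewrite deriveE ?mxE//; exact: smooth_differentiable sphi _ Uz.
suff H l : l = 'D_(delta_mx 0 i) phi x 0 j -> (fun z => 'J phi z i j) @ x --> l.
  by apply: H; exact: JE.
move=> ->.
have cD := smooth_derive_continuous sphi (v := delta_mx 0 i) Ux.
have Dj := (@cvg_mxP R _ (nbhs x) (nbhs_filter x) _ _ (fun z => 'D_(delta_mx 0 i) phi z)
  ('D_(delta_mx 0 i) phi x)).1 cD 0 j.
apply: (cvg_trans _ Dj).
apply: (@near_eq_cvg _ _ (nbhs x) (nbhs_filter x)); near=> z.
by apply/esym/JE; near: z; exact: open_nbhs_nbhs.
Unshelve. all: by end_near. Qed.

Lemma linear_row_sum (W : lmodType R) (f : 'rV[R]_n -> W) (v : 'rV[R]_n) : linear f ->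
  f v = \sum_i v 0 i *: f (delta_mx 0 i).
Proof.
move=> lf; pose F : {linear 'rV[R]_n -> W} :=
  HB.pack f (GRing.isLinear.Build R _ _ *:%R f lf).
rewrite -[f]/(F : _ -> _) {1}(row_sum_delta v) linear_sum.
by apply: eq_bigr => i _; rewrite linearZ.
Qed.

End Charts.

(** * The equation of geodesics *)

Section Geodesics.
Context {R : realType} {n : nat} {M : smooth_manifold R n}.
Variable nabla : connection M.
Implicit Types (c d : chart R n M) (v w : 'rV[R]_n) (gamma : R -> M).

(** Expanding in a basis turns the Christoffel symbols, whose dependence on the
    point alone is assumed smooth, into jointly continuous functions. *)
Lemma christoffel_sum c x v w : atlas c -> img c x ->
  christoffel nabla c x v w =
  \sum_i \sum_j (v 0 i * w 0 j) *:
     christoffel nabla c x (delta_mx 0 i) (delta_mx 0 j).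
Proof.
move=> ac cx; rewrite (linear_row_sum _ (christoffel_linearl nabla w ac cx)).
apply: eq_bigr => i _.
rewrite (linear_row_sum _ (christoffel_linearr nabla _ ac cx)) scaler_sumr.
by apply: eq_bigr => j _; rewrite scalerA.
Qed.

Lemma christoffel_continuous {T : Type} (F : set_system T) {FF : Filter F} c
    (x v w : T -> 'rV[R]_n) x0 v0 w0 : atlas c -> img c x0 ->
  x @ F --> x0 -> v @ F --> v0 -> w @ F --> w0 ->
  (fun t => christoffel nabla c (x t) (v t) (w t)) @ F -->
    christoffel nabla c x0 v0 w0.
Proof.
move=> ac cx0 xx0 /cvg_mxP vv0 /cvg_mxP ww0.
rewrite christoffel_sum//.
apply: (@cvg_trans _ ((fun t => \sum_i \sum_j (v t 0 i * w t 0 j) *: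
     christoffel nabla c (x t) (delta_mx 0 i) (delta_mx 0 j)) @ F)).
  apply: near_eq_cvg.
  have : \forall t \near F, img c (x t).
    by apply: xx0; apply: open_nbhs_nbhs; split => //; exact: coord_dom_open.
  by apply: filterS => t cxt; rewrite christoffel_sum.
apply: cvg_bigsum => i; apply: cvg_bigsum => j; apply: cvgZ.
  by apply: cvgM.
apply: (cvg_comp x (fun z => christoffel nabla c z (delta_mx 0 i) (delta_mx 0 j)) xx0).
have sm := christoffel_smooth nabla (delta_mx 0 i) (delta_mx 0 j) ac.
exact: (differentiable_continuous (smooth_differentiable sm cx0)).
Qed.

(** The equation of geodesics as a first-order equation for the row [(x, v)] of
    position and velocity. *)
Lemma geodesic_local_existence c x0 v0 : atlas c -> img c x0 ->
  exists2 e : R, 0 < e & exists x v : R -> 'rV[R]_n, [/\ x 0 = x0, v 0 = v0 &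
    forall t : R, `|t| < e -> [/\ img c (x t), is_derive t 1 x (v t) &
      is_derive t 1 v (- christoffel nabla c (x t) (v t) (v t))]].
Proof.
move=> ac cx0.
(* [y *m Lm] is the position and [y *m Rm] the velocity; [G] is the expansion of
   the Christoffel term, quadratic in the velocity at all points, whereas the
   symbols themselves are bilinear only on the image of the chart *)
pose Lm : 'M[R]_(n + n, n) := col_mx 1%:M 0.
pose Rm : 'M[R]_(n + n, n) := col_mx 0 1%:M.
pose G (y : 'rV[R]_(n + n)) := \sum_i \sum_j
  ((y *m Rm) 0 i * (y *m Rm) 0 j) *:
     christoffel nabla c (y *m Lm) (delta_mx 0 i) (delta_mx 0 j).
pose Phi y := (y *m Rm) *m row_mx 1%:M 0 + G y *m row_mx 0 (- 1%:M).
pose y0 := row_mx x0 v0.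
have y0L : y0 *m Lm = x0 by rewrite mul_row_col mulmx1 mulmx0 addr0.
have y0R : y0 *m Rm = v0 by rewrite mul_row_col mulmx1 mulmx0 add0r.
have lip : locally_lipschitz Phi y0.
  apply: locally_lipschitzD; apply: locally_lipschitz_mulmxr.
    by apply: locally_lipschitz_mulmxr; exact: locally_lipschitz_id.
  apply: locally_lipschitz_sum => i; apply: locally_lipschitz_sum => j.
  have cr k : locally_lipschitz (fun y : 'rV[R]_(n + n) => (y *m Rm) 0 k) y0.
    apply: (locally_lipschitz_comp_mulmx (g := fun z : 'rV[R]_n => z 0 k)).
    exact: locally_lipschitz_coord.
  apply: locally_lipschitzZ.
    by apply: (@locally_lipschitzZ _ _ R); exact: cr.
  apply: (locally_lipschitz_comp_mulmx (g := fun z => christoffel nabla c z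
    (delta_mx 0 i) (delta_mx 0 j))); rewrite y0L.
  have sm := christoffel_smooth nabla (delta_mx 0 i) (delta_mx 0 j) ac.
  apply: (@locally_lipschitz_C1 _ _ _ _ (img c)) => //.
  - exact: coord_dom_open.
  - exact: smooth_differentiable sm.
  - by move=> v; apply: smooth_derive_continuous sm _ _ _.
have [e e0 [y [y0E dy]]] := picard lip.
have dyA t (A : 'M[R]_(n + n, n)) : `|t| < e ->
    is_derive t (1 : R) (fun s => y s *m A) (Phi (y t) *m A).
  move=> te; apply: is_derive_eq.
    exact: (is_derive_mulmx (dy t te) (is_derive_cst A t (1 : R))).
  by rewrite mulmx0 addr0.
have LmE : row_mx 1%:M 0 *m Lm = 1%:M :> 'M[R]_n.
  by rewrite mul_row_col mulmx1 mulmx0 addr0.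
have LmE' : row_mx 0 (- 1%:M) *m Lm = 0 :> 'M[R]_n.
  by rewrite mul_row_col mulmx0 mul0mx addr0.
have RmE : row_mx 1%:M 0 *m Rm = 0 :> 'M[R]_n.
  by rewrite mul_row_col mulmx0 mul0mx addr0.
have RmE' : row_mx 0 (- 1%:M) *m Rm = - 1%:M :> 'M[R]_n.
  by rewrite mul_row_col mulmx0 mulmx1 add0r.
have : \forall t \near (0 : R), img c (y t *m Lm).
  have yc : (fun s => y s *m Lm) @ (0 : R) --> y 0 *m Lm.
    by apply: (is_derive_continuous (dyA 0 Lm _)); rewrite normr0.
  apply: yc; rewrite y0E y0L; apply: open_nbhs_nbhs; split => //.
  exact: coord_dom_open.
move=> /nbhs_ballP[d /= d0 dH].
exists (Num.min e d); first by rewrite lt_min e0.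
exists (fun t => y t *m Lm), (fun t => y t *m Rm); split; rewrite ?y0E//.
move=> t; rewrite lt_min => /andP[te td].
have ct : img c (y t *m Lm) by apply: dH; rewrite -ball_normE /= sub0r normrN.
split => //.
  apply: is_derive_eq; first exact: dyA.
  by rewrite mulmxDl -!mulmxA LmE LmE' mulmx0 addr0 !mulmx1.
apply: is_derive_eq; first exact: dyA.
rewrite mulmxDl -!mulmxA RmE RmE' !mulmx0 add0r mulmxN mulmx1.
by rewrite christoffel_sum.
Qed.

(** The local part of the definition of geodesics.  It depends only on the germ of
    the curve, which is what makes gluing possible. *)
Definition geodesic_at gamma (t : R) :=
  {for t, continuous gamma} /\
  forall c, atlas c -> dom c (gamma t) ->
    let u := coord c \o gamma in
    [/\ derivable u t 1, derivable (derive1 u) t 1 &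
        derive1 (derive1 u) t +
          christoffel nabla c (u t) (derive1 u t) (derive1 u t) = 0].

Lemma geodesic_geodesic_at (I : set R) gamma t :
  geodesic nabla I gamma -> I t -> geodesic_at gamma t.
Proof. by move=> [_ _ _ gc ge] It; split; [exact: gc|move=> c ac; exact: ge]. Qed.

(** The geodesic equation need only be checked in one chart, by the
    transformation law of the Christoffel symbols. *)
Lemma geodesic_at_of_chart c gamma (x v : R -> 'rV[R]_n) (t : R) : atlas c ->
  (\forall s \near t, img c (x s) /\ gamma s = param c (x s)) ->
  (\forall s \near t, is_derive s (1 : R) x (v s)) ->
  is_derive t 1 v (- christoffel nabla c (x t) (v t) (v t)) ->
  geodesic_at gamma t.
Proof.
move=> ac near_x near_dx dv.
have [cxt gt] := nbhs_singleton near_x.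
have dx := nbhs_singleton near_dx.
have xc := is_derive_continuous dx.
have : gamma @ t --> param c (x t).
  apply: (@cvg_trans _ ((param c \o x) @ t)).
    by apply: near_eq_cvg; apply: filterS near_x => s [_ ->].
  by apply: cvg_comp xc _; exact: param_continuous.
rewrite -gt => gc; split; first exact: gc.
move=> d ad dgt u; pose tau := transition c d.
have sm : smooth_on (overlap c d) tau by exact: atlas_smooth.
have ot : overlap c d (x t) by split; rewrite -?gt.
have near_o : \forall s \near t, overlap c d (x s).
  by apply: xc; apply: open_nbhs_nbhs; split => //; exact: overlap_open.
have near_u : \forall s \near t, tau (x s) = u s.
  by apply: filterS near_x => s [_ gs]; rewrite /u /tau /transition /= gs.
have ux s : overlap c d (x s) -> is_derive s (1 : R) x (v s) ->
    is_derive s (1 : R) (tau \o x) ('d tau (x s) (v s)).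
  by move=> os dxs; apply: is_derive_comp_diff => //; exact: smooth_differentiable sm _ os.
have near_du : \forall s \near t, is_derive s (1 : R) u (v s *m 'J tau (x s)).
  have near_near : \forall s \near t, \forall r \near s, tau (x r) = u r.
    exact: near_join.
  near=> s.
  have os : overlap c d (x s) by near: s.
  apply: (@near_eq_is_derive _ _ _ (tau \o x)); first by near: s.
  apply: is_derive_eq; first by apply: ux => //; near: s.
  by rewrite -deriveEjacobian ?deriveE//; exact: smooth_differentiable sm _ os.
have near_u' : \forall s \near t, v s *m 'J tau (x s) = derive1 u s.
  by apply: filterS near_du => s [_ <-]; rewrite derive1E.
have [J' dJ JE] := is_derive_jacobian (@overlap_open _ _ _ c d)
  (smooth_differentiable sm) (smooth_derive_differentiable sm) ot dx.
have ddu := near_eq_is_derive near_u' (is_derive_mulmx dv dJ).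
have [ud _] := nbhs_singleton near_du.
have [ud' ude] := ddu; split; [exact: ud|exact: ud'|].
have u't := nbhs_singleton near_u'.
have taud := smooth_differentiable sm ot.
have JD w : w *m 'J tau (x t) = 'd tau (x t) w.
  by rewrite -deriveEjacobian ?deriveE.
rewrite derive1E ude -u't -(nbhs_singleton near_u).
rewrite -JE !JD linearN /= christoffel_transform//.
by rewrite opprD addrAC subrK addNr.
Unshelve. all: by end_near. Qed.

Lemma geodesic_at_near gamma delta (t : R) :
  (\forall s \near t, gamma s = delta s) ->
  geodesic_at gamma t -> geodesic_at delta t.
Proof.
move=> gd [gc ge]; have gdt := nbhs_singleton gd; split.
  suff : delta @ t --> gamma t by rewrite gdt.
  by apply: (cvg_trans _ gc); apply: near_eq_cvg; apply: filterS gd => s ->.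
move=> c ac dt u; have [] := ge c ac; first by rewrite gdt.
set u0 := coord c \o gamma => d1 d2 ode.
have uu : \forall s \near t, u0 s = u s.
  by apply: filterS gd => s gs; rewrite /u /u0 /= gs.
have uu' : \forall s \near t, derive1 u0 s = derive1 u s.
  apply: filterS (near_join uu) => s us.
  by rewrite !derive1E; exact: near_eq_derive.
split; [exact: near_eq_derivable d1|exact: near_eq_derivable d2|].
rewrite -(nbhs_singleton uu) -(nbhs_singleton uu').
by rewrite derive1E -(near_eq_derive _ uu') -derive1E.
Qed.

Lemma geodesic_in_chart (I : set R) gamma c t : geodesic nabla I gamma ->
  atlas c -> I t -> dom c (gamma t) -> let u := coord c \o gamma in
  [/\ \forall s \near t, I s /\ dom c (gamma s),
      is_derive t 1 u (derive1 u t) &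
      is_derive t 1 (derive1 u)
        (- christoffel nabla c (u t) (derive1 u t) (derive1 u t))].
Proof.
move=> [oI _ _ gc ge] ac It ct u; split.
- apply: filterI; first exact: open_nbhs_nbhs.
  apply: (gc t It); apply: open_nbhs_nbhs; split => //; exact: dom_open.
- have [ud _ _] := ge c t ac It ct.
  by split; [exact: ud|rewrite derive1E].
- have [_ ud' ode] := ge c t ac It ct; split => //; rewrite -derive1E.
  by apply/eqP; rewrite -addr_eq0; apply/eqP.
Qed.

End Geodesics.

(** * The sphere *)

Section Sphere.
Context {R : realType} {n : nat}.

Lemma unit_sphere_closed m : closed (@unit_sphere R m).
Proof.
rewrite (_ : unit_sphere (m := m) =
  (fun y : 'rV[R]_m => \sum_(i < m) y 0 i ^+ 2) @^-1` [set 1]) //.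
apply: preimage_closed; last exact: closed_eq.
move=> y _; apply: (@cvg_bigsum _ _ (nbhs y) _ R _ _ (fun i z => z 0 i ^+ 2)).
by move=> i; apply: cvgM; exact: matrix_normedtype.coord_continuous.
Qed.

Lemma unit_sphere_compact m : compact (@unit_sphere R m).
Proof.
apply: bounded_closed_compact; last exact: unit_sphere_closed.
exists 1; split => // K K1 y yS; apply: le_trans (ltW K1).
apply: mx_norm_leP => // i j; rewrite ord1 -(@ler_pXn2r _ 2)// ?nnegrE//.
rewrite expr1n -normrX ger0_norm ?sqr_ge0// -yS (bigD1 j)//= lerDl.
by apply: sumr_ge0 => k _; rewrite sqr_ge0.
Qed.

(** The inverse of the diffeomorphism is continuous on the sphere, for the topology
    induced by the ambient space. *)
Lemma sphere_param_near (M : smooth_manifold R n) (k : 'rV[R]_n.+1 -> M) y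
    (U : set M) : smooth_from_sphere k -> unit_sphere y -> nbhs (k y) U ->
  \forall z \near y, unit_sphere z -> U (k z).
Proof.
move=> ks yS kU; have [c ac cy] := atlas_cover (k y).
have [V [G [oV Vy Gs GE]]] := ks y c yS ac cy.
have Vn : \forall z \near y, V z by apply: open_nbhs_nbhs.
have Gc : G @ y --> G y.
  apply: differentiable_continuous; exact: smooth_differentiable Gs _ Vy.
have [_ GyE] := GE y Vy yS.
have : param c @ coord c (k y) --> k y.
  rewrite -{2}(coordK cy); apply: param_continuous; exact: img_coord.
rewrite GyE => pc; have near_U := cvg_comp _ _ Gc pc U kU.
near=> z => zS; have [|cz Gz] := GE z _ zS; first by near: z.
rewrite -(coordK cz) Gz; near: z; exact: near_U.
Unshelve. all: by end_near. Qed.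

End Sphere.

(** * Completeness from bounds on the velocity *)

Section Extension.
Context {R : realType} {n : nat} {M : smooth_manifold R n}.
Variable nabla : connection M.
Implicit Types (I : set R) (gamma : R -> M).

(** The components of the velocity, and hence their norm, depend on the chart; a
    bound makes sense only in a chart around each point. *)
Definition locally_bounded_velocity I gamma := forall p : M,
  exists c (B : R), [/\ atlas c, dom c p & \forall q \near p,
    forall t, I t -> gamma t = q -> `|derive1 (coord c \o gamma) t| <= B].

(** In the ambient space of the sphere the speed does not depend on a chart, and
    the local bounds become global by compactness of the sphere. *)
Lemma bounded_sphere_speed I gamma h k :
  geodesic nabla I gamma -> locally_bounded_velocity I gamma ->
  (forall p : M, unit_sphere (h p)) -> (forall p, k (h p) = p) ->
  smooth_map h -> smooth_from_sphere k ->
  exists B, forall t, I t ->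
    exists2 dh, is_derive t 1 (h \o gamma) dh & `|dh| <= B.
Proof.
move=> geo lbv hS hK hs ks.
have /compact_near_coveringP nc := @unit_sphere_compact R n.+1.
pose P (B : R) (y : 'rV[R]_n.+1) := forall t, I t -> h (gamma t) = y ->
    exists2 dh, is_derive t 1 (h \o gamma) dh & `|dh| <= B.
have [|B _ HB] := @pinfty_ex_gt0 R (fun B => unit_sphere (m := n.+1) `<=` P B).
  apply: (nc R +oo P) => y yS.
  have [c [B [ac cy lb]]] := lbv (k y).
  pose phi := h \o param c; pose x0 := coord c (k y).
  have hc : smooth_on (img c) phi := hs c ac.
  have cx0 : img c x0 by exact: img_coord.
  have Jc := jacobian_continuous (img_open (c := c)) hc cx0.
  pose K := n%:R * B * (`|'J phi x0| + 1).
  have near_q : \forall q \near k y, [/\ dom c q,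
      forall t, I t -> gamma t = q -> `|derive1 (coord c \o gamma) t| <= B &
      `|'J phi (coord c q)| <= `|'J phi x0| + 1].
    near=> q; split.
    - by near: q; apply: open_nbhs_nbhs; split => //; exact: dom_open.
    - by near: q.
    - have : `|'J phi x0 - 'J phi (coord c q)| <= 1.
        near: q; have cc := Defs.coord_continuous cy.
        have JJ := cvg_comp _ _ cc Jc.
        by move/cvgrPdist_le : JJ; apply.
      rewrite distrC => H; rewrite -['J phi (coord c q)](subrKC ('J phi x0)).
      by rewrite (le_trans (ler_normD _ _))// lerD.
  have near_z := sphere_param_near ks yS near_q.
  exists ([set z | unit_sphere z ->
    [/\ dom c (k z),
      forall t, I t -> gamma t = k z -> `|derive1 (coord c \o gamma) t| <= B &
      `|'J phi (coord c (k z))| <= `|'J phi x0| + 1]], [set B' | K <= B']).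
    by split; [exact: near_z|apply: nbhs_pinfty_ge; exact: num_real].
  move=> [z B'] [/= Hz KB'] t It ht.
  have gk : gamma t = k z by rewrite -ht hK.
  have [|cz lbz Jz] := Hz; first by rewrite -ht.
  have ct : dom c (gamma t) by rewrite gk.
  have [near_t du _] := geodesic_in_chart geo ac It ct.
  set u := coord c \o gamma in du.
  have phid : differentiable phi (u t).
    by apply: smooth_differentiable hc _ _; exact: img_coord.
  have dphi := is_derive_comp_diff du phid.
  exists ('d phi (u t) (derive1 u t)).
    apply: near_eq_is_derive dphi.
    by apply: filterS near_t => s [_ cs]; rewrite /phi /u /= coordK.
  apply: le_trans KB'; rewrite -deriveE// deriveEjacobian//.
  have uB : `|derive1 u t| <= B := lbz t It gk.
  have JB : `|'J phi (u t)| <= `|'J phi x0| + 1 by rewrite /u /= gk.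
  apply: (le_trans (mulmx_norm_le (derive1 u t) ('J phi (u t)))).
  apply: ler_pM; [|exact: normr_ge0| |exact: JB].
    by apply: mulr_ge0; [exact: ler0n|exact: normr_ge0].
  by apply: ler_wpM2l; [exact: ler0n|exact: uB].
exists B => t It; exact: (HB (h (gamma t)) (hS _) t It).
Unshelve. all: by end_near. Qed.

(** The curve [X] with velocity [V] is the geodesic, read in a chart around its limit
    at [b], up to the time [b] and a solution of the equation of geodesics from then
    on.  At [b] it is differentiable because its derivative off [b] extends
    continuously. *)
Lemma geodesic_extend_right I gamma (a b : R) : diffeomorphic_to_sphere M ->
  geodesic nabla I gamma -> locally_bounded_velocity I gamma ->
  a < b -> (forall t, a <= t < b -> I t) -> ~ I b ->
  exists J delta, [/\ geodesic nabla J delta, I `<=` J,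
    forall t, I t -> delta t = gamma t & J b].
Proof.
move=> [h [k [hS hK kK hs ks]]] geo lbv ab Iab nIb.
have [oI _ itvI _ _] := geo.
have Ia : I a by apply: Iab; rewrite lexx.
have Ilt t : I t -> t < b.
  move=> It; rewrite ltNge; apply/negP => bt; apply: nIb.
  by apply: (itvI a t) => //; rewrite (ltW ab).
(* the curve converges at [b], first in the sphere, then in [M] *)
have [B HB] := bounded_sphere_speed geo lbv hS hK hs ks.
have /choice[dh Hdh] t : exists dh, I t ->
    is_derive t 1 (h \o gamma) dh /\ `|dh| <= B.
  have [/HB[dh ? ?]|] := pselect (I t); first by exists dh.
  by exists 0.
have [y hy] := cvg_at_left_of_bounded_derive ab
  (fun t tab => (Hdh t (Iab t tab)).1) (fun t tab => (Hdh t (Iab t tab)).2).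
have yS : unit_sphere y.
  apply: (closed_cvg _ (@unit_sphere_closed R n.+1) _ y hy).
  by near=> t; exact: hS.
pose p := k y.
have gp : gamma @ b^'- --> p.
  move=> U pU; have H : \forall t \near b^'-,
      unit_sphere (h (gamma t)) -> U (k (h (gamma t))).
    exact: (hy _ (sphere_param_near ks yS pU)).
  by apply: (filterS _ H) => t /(_ (hS _)); rewrite hK.
(* convergence of the coordinates and of the velocity in a chart at the limit *)
have [c [C [ac cp lb]]] := lbv p.
pose u := coord c \o gamma; pose x0 := coord c p.
have cx0 : img c x0 by exact: img_coord.
have ux0 : u @ b^'- --> x0 := cvg_comp _ _ gp (Defs.coord_continuous cp).
have Gx0 i j :
    (fun t => christoffel nabla c (u t) (delta_mx 0 i) (delta_mx 0 j)) @ b^'- -->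
    christoffel nabla c x0 (delta_mx 0 i) (delta_mx 0 j).
  by apply: christoffel_continuous ac cx0 ux0 _ _; exact: cvg_cst.
have near_lb : \forall t \near b^'-, forall r, I r -> gamma r = gamma t ->
  `|derive1 u r| <= C := gp _ lb.
have [a1 a1b Ha1] : exists2 a1, a <= a1 < b & forall t, a1 <= t < b ->
    [/\ dom c (gamma t), `|derive1 u t| <= C &
      forall i j, `|christoffel nabla c (u t) (delta_mx 0 i) (delta_mx 0 j)| <=
        `|christoffel nabla c x0 (delta_mx 0 i) (delta_mx 0 j)| + 1].
  apply: near_at_leftP => //; near=> t; split.
  - near: t; apply: gp; apply: open_nbhs_nbhs; split => //; exact: dom_open.
  - have It : I t by near: t; apply: (near_at_left ab).
    by exact: (near near_lb t _ t It erefl).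
  - near: t; apply: filter_forall => i; apply: filter_forall => j.
    have /cvgrPdist_le/(_ 1 ltr01) := Gx0 i j; apply: filterS => t; rewrite distrC => H.
    rewrite -[X in `|X| <= _](subrKC
      (christoffel nabla c x0 (delta_mx 0 i) (delta_mx 0 j))).
    by rewrite (le_trans (ler_normD _ _))// lerD.
have /andP[aa1 a1b'] := a1b.
have Ia1 t : a1 <= t < b -> I t.
  by move=> /andP[h1 h2]; apply: Iab; rewrite h2 (le_trans aa1).
have geoc t (tb : a1 <= t < b) :=
  geodesic_in_chart geo ac (Ia1 t tb) (let: And3 ct _ _ := Ha1 t tb in ct).
pose A t := - christoffel nabla c (u t) (derive1 u t) (derive1 u t).
pose D := \sum_i \sum_j (C * C) *
  (`|christoffel nabla c x0 (delta_mx 0 i) (delta_mx 0 j)| + 1).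
have AD t : a1 <= t < b -> `|A t| <= D.
  move=> /Ha1[ct uC GC]; rewrite normrN christoffel_sum//; last exact: img_coord.
  rewrite (le_trans (ler_norm_sum _ _ _))//; apply: ler_sum => i _.
  rewrite (le_trans (ler_norm_sum _ _ _))//; apply: ler_sum => j _.
  rewrite normrZ normrM ler_pM ?mulr_ge0// ler_pM//.
    by rewrite (le_trans (mx_entry_le _ _ _)).
  by rewrite (le_trans (mx_entry_le _ _ _)).
have [v0 uv0] : exists v0 : 'rV[R]_n, derive1 u @ b^'- --> v0.
  by apply: (cvg_at_left_of_bounded_derive a1b') AD => t /geoc[].
(* the solution of the geodesic equation starting from the limit *)
have [e e0 [x [v [x0E v0E Hxv]]]] := geodesic_local_existence nabla v0 ac cx0.
have Hxvb t : b - e < t < b + e -> [/\ img c (x (t - b)),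
    is_derive t 1 (fun s => x (s - b)) (v (t - b)) &
    is_derive t 1 (fun s => v (s - b))
      (- christoffel nabla c (x (t - b)) (v (t - b)) (v (t - b)))].
  move=> /andP[h1 h2]; have [|cx dx dv] := Hxv (t - b).
    by rewrite ltr_norml; apply/andP; split; lra.
  by split => //; apply: is_derive_shift_arg.
pose X t := if t < b then u t else x (t - b).
pose V t := if t < b then derive1 u t else v (t - b).
pose G t := - christoffel nabla c (X t) (V t) (V t).
have bbe : b - e < b < b + e by apply/andP; split; lra.
have [_ dxb dvb] := Hxvb b bbe.
have Xb : X b = x0 by rewrite /X ltxx subrr.
have Vb : V b = v0 by rewrite /V ltxx subrr.
have Xc : X @ b --> X b.
  rewrite Xb -x0E -(subrr b); apply: (cvg_glue (g := fun s => x (s - b))).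
    by rewrite subrr x0E.
  exact: is_derive_continuous dxb.
have Vc : V @ b --> V b.
  rewrite Vb -v0E -(subrr b); apply: (cvg_glue (g := fun s => v (s - b))).
    by rewrite subrr v0E.
  exact: is_derive_continuous dvb.
have Gc : G @ b --> G b.
  by apply: cvgN; apply: christoffel_continuous => //; rewrite Xb.
have Himg t : a1 <= t < b + e -> img c (X t).
  move=> /andP[h1 h2]; rewrite /X; case: ltP => tb.
    by apply: img_coord; have [] := Ha1 t; rewrite ?h1.
  by have [|] := Hxvb t; first by apply/andP; split; lra.
have Hd t : a1 < t < b + e -> t != b ->
    is_derive t (1 : R) X (V t) /\ is_derive t (1 : R) V (G t).
  move=> /andP[h1 h2]; rewrite neq_lt => /orP[tb|bt].
    have [|_ du ddu] := geoc t; first by rewrite tb ltW.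
    have near_b : \forall s \near t, s < b by exact: lt_nbhsl.
    rewrite /G /V /X tb; split.
      by apply: near_eq_is_derive du; near do rewrite /X ifT//.
    by apply: near_eq_is_derive ddu; near do rewrite /V ifT//.
  have [|_ du ddu] := Hxvb t; first by apply/andP; split; lra.
  have near_b : \forall s \near t, b < s by exact: lt_nbhsr.
  rewrite /G /V /X ltNge (ltW bt) /=; split.
    by apply: near_eq_is_derive du; near do rewrite /X ltNge ltW//.
  by apply: near_eq_is_derive ddu; near do rewrite /V ltNge ltW//.
have near_itv t : a1 < t < b + e -> \forall s \near t, a1 < s < b + e.
  move=> /andP[h1 h2]; near=> s; apply/andP; split.
    by near: s; exact: lt_nbhsr.
  by near: s; exact: lt_nbhsl.
have a1be : a1 < b < b + e by rewrite a1b'; lra.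
have Hd' t : a1 < t < b + e ->
    is_derive t (1 : R) X (V t) /\ is_derive t (1 : R) V (G t).
  move=> ht; have [->|] := eqVneq t b; last exact: Hd.
  by split; apply: is_derive_of_continuous => //;
    apply: filterS (near_itv _ a1be) => s hs' /(Hd _ hs')[].
pose delta t := if t < b then gamma t else param c (x (t - b)).
have dE t : a1 <= t < b + e -> delta t = param c (X t).
  move=> /andP[h1 h2]; rewrite /delta /X; case: ltP => tb //.
  by rewrite /u /= coordK//; have [] := Ha1 t; rewrite ?h1.
have dgeo t : b <= t < b + e -> geodesic_at nabla delta t.
  move=> /andP[h1 h2]; have ht : a1 < t < b + e by rewrite h2 (lt_le_trans a1b').
  apply: (@geodesic_at_of_chart _ _ _ nabla c delta X V t ac).
  - apply: filterS (near_itv _ ht) => s /andP[/ltW k1 k2].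
    by split; [apply: Himg|apply: dE]; rewrite k1.
  - by apply: filterS (near_itv _ ht) => s /Hd'[].
  - by have [] := Hd' t ht.
pose J := [set t | I t \/ b <= t < b + e].
have dI t : I t -> geodesic_at nabla delta t.
  move=> It; apply: geodesic_at_near (geodesic_geodesic_at geo It).
  have : \forall s \near t, s < b by apply: lt_nbhsl; exact: Ilt.
  by apply: filterS => s sb; rewrite /delta sb.
have Jgeo t : J t -> geodesic_at nabla delta t by case; [exact: dI|exact: dgeo].
exists J, delta; split; [split| | |].
- rewrite openE => t [It|tb].
    have : \forall s \near t, I s by exact: open_nbhs_nbhs.
    by apply: filterS => s Is; left.
  have /near_itv : a1 < t < b + e.
    by move: tb => /andP[h1 ->]; rewrite (lt_le_trans a1b').
  apply: filterS => s /andP[h1 h2]; have [sb|bs] := ltP s b.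
    by left; apply: Ia1; rewrite sb ltW.
  by right; rewrite bs.
- by exists a; left.
- move=> s t Js Jt z /andP[sz zt]; have [zb|bz] := ltP z b; last first.
    right; rewrite bz /=; case: Jt => [/Ilt tb|/andP[_ tbe]].
      by have := lt_le_trans tb (le_trans bz zt); rewrite ltxx.
    exact: le_lt_trans tbe.
  left; have [za|az] := ltP z a; last by apply: Iab; rewrite az.
  case: Js => [Is|/andP[bs _]]; last by move: (le_trans bs sz); rewrite leNgt zb.
  by apply: (itvI s a) => //; rewrite sz ltW.
- by move=> t /Jgeo[].
- by move=> d t ad /Jgeo[_ H]; exact: H.
- by move=> t It; left.
- by move=> t It; rewrite /delta Ilt.
- by right; rewrite lexx ltrDl.
Unshelve. all: by end_near. Qed.

Lemma geodesic_rev I gamma : geodesic nabla I gamma ->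
  geodesic nabla [set t | I (- t)] (fun t => gamma (- t)).
Proof.
move=> geo; have [oI [a Ia] itvI gc ge] := geo.
have gat t : I (- t) -> geodesic_at nabla (fun t => gamma (- t)) t.
  move=> It; have [c ac ct] := atlas_cover (gamma (- t)).
  pose u := coord c \o gamma.
  have nc : (fun s : R => - s) @ t --> - t by exact: opp_continuous.
  have [near_t _ ddu] := geodesic_in_chart geo ac It ct.
  have near_s : \forall s \near t, I (- s) /\ dom c (gamma (- s)) := nc _ near_t.
  apply: (@geodesic_at_of_chart _ _ _ nabla c _ (fun s => u (- s))
    (fun s => - derive1 u (- s)) t ac).
  - apply: filterS near_s => s [_ cs].
    by split; [exact: img_coord|rewrite /u /= coordK].
  - apply: filterS near_s => s [Is cs].
    by have [_ du _] := geodesic_in_chart geo ac Is cs; exact: is_derive_opp_arg.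
  - have H := is_deriveN (is_derive_opp_arg ddu).
    apply: is_derive_eq H _; rewrite opprK; congr (- _).
    have cut : img c (u (- t)) by exact: img_coord.
    rewrite christoffel_sum// [RHS]christoffel_sum//.
    apply: eq_bigr => i _; apply: eq_bigr => j _.
    by rewrite !mxE mulrNN.
split.
- rewrite openE => t It.
  have It' : \forall s \near - t, I s by exact: open_nbhs_nbhs.
  have nc : (fun s : R => - s) @ t --> - t by exact: opp_continuous.
  exact: (nc _ It').
- by exists (- a); rewrite /= opprK.
- move=> s t Is It z /andP[sz zt]; apply: (itvI (- t) (- s)) => //.
  by rewrite !lerN2 zt.
- by move=> t /gat[].
- by move=> c t ac /gat[_ H]; exact: H.
Qed.

Lemma locally_bounded_velocity_rev I gamma :
  geodesic nabla I gamma -> locally_bounded_velocity I gamma ->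
  locally_bounded_velocity [set t | I (- t)] (fun t => gamma (- t)).
Proof.
move=> geo lbv p; have [c [B [ac cp lb]]] := lbv p; exists c, B; split => //.
near=> q => t It gq.
have cq : dom c q by near: q; apply: open_nbhs_nbhs; split => //; exact: dom_open.
have ct : dom c (gamma (- t)) by rewrite gq.
have [_ du _] := geodesic_in_chart geo ac It ct.
have [_] := is_derive_opp_arg du; rewrite -derive1E => ->.
by rewrite normrN; apply: (near lb q _ (- t) It gq).
Unshelve. all: by end_near. Qed.

Lemma geodesic_extend_above I gamma (a s : R) : diffeomorphic_to_sphere M ->
  geodesic nabla I gamma -> locally_bounded_velocity I gamma ->
  I a -> ~ I s -> a < s ->
  exists J delta, [/\ geodesic nabla J delta, I `<=` J,
    forall t, I t -> delta t = gamma t & ~ J `<=` I].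
Proof.
move=> dM geo lbv Ia nIs as_; have [oI _ itvI _ _] := geo.
have ubI : ubound I s.
  move=> t It; rewrite leNgt; apply/negP => st; apply: nIs.
  by apply: (itvI a t) => //; rewrite !ltW.
have supI : has_sup I by split; [exists a | exists s].
pose b := sup I.
have ab : a <= b by apply: ub_le_sup; [exists s|].
have nIb : ~ I b.
  move=> Ib; have : \forall t \near b, I t by exact: open_nbhs_nbhs.
  move=> /nbhs_ballP[e /= e0 He].
  have /He It : ball b e (b + e / 2).
    by rewrite -ball_normE /= opprD addNKr normrN gtr0_norm ?divr_gt0//; lra.
  have : b + e / 2 <= b by apply: ub_le_sup It; exists s.
  by have := e0; lra.
have ab' : a < b by rewrite lt_neqAle ab andbT; apply/eqP => E; rewrite -E in nIb.
have Iab t : a <= t < b -> I t.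
  move=> /andP[at_ tb]; have tb0 : 0 < b - t by rewrite subr_gt0.
  have [r Ir] := sup_adherent tb0 supI; rewrite subKr => tr.
  by apply: (itvI a r) => //; rewrite at_ ltW.
have [J [delta [gJ IJ dg Jb]]] := geodesic_extend_right dM geo lbv ab' Iab nIb.
by exists J, delta; split => // /(_ b Jb).
Qed.

(** Time reversal exchanges the two ends of the interval, so that it suffices to
    extend geodesics that end on the right. *)
Theorem maximal_geodesic_complete I gamma : diffeomorphic_to_sphere M ->
  maximal_geodesic nabla I gamma -> locally_bounded_velocity I gamma ->
  I = setT.
Proof.
move=> dM [geo max] lbv; apply/seteqP; split => // s _.
apply: contrapT => nIs; have [_ [a Ia] _ _ _] := geo.
have : a != s by apply/eqP => E; rewrite E in Ia.
rewrite neq_lt => /orP[as_|sa].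
  have [J [delta [gJ IJ dg nJI]]] := geodesic_extend_above dM geo lbv Ia nIs as_.
  by apply: nJI; rewrite (max J delta).
have [|||J [delta [gJ IJ dg nJI]]] := @geodesic_extend_above
  _ _ (- a) (- s) dM (geodesic_rev geo) (locally_bounded_velocity_rev geo lbv).
- by rewrite /= opprK.
- by rewrite /= opprK.
- by rewrite ltrN2.
apply: nJI => t Jt /=.
rewrite -(max _ _ (geodesic_rev gJ)) /= ?opprK//.
  by move=> r Ir; apply: IJ; rewrite /= opprK.
by move=> r Ir; rewrite dg /= opprK.
Qed.

End Extension.

Section LowerBound.
Context {R : realType} {n : nat} {M : smooth_manifold R n}.

(** To bound the velocity near a point, it suffices to bound its image under a
    continuous family of injective linear maps. *)
Lemma locally_bounded_velocity_of_row_free (I : set R) (gamma : R -> M) :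
  (forall p : M, exists c k (B : 'rV[R]_n -> 'M[R]_(n, k)) (D : R),
    [/\ atlas c, dom c p, B @ coord c p --> B (coord c p),
        row_free (B (coord c p)) &
        \forall x \near coord c p, forall t, I t -> dom c (gamma t) ->
          coord c (gamma t) = x ->
          `|derive1 (coord c \o gamma) t *m B x| <= D]) ->
  locally_bounded_velocity I gamma.
Proof.
move=> H p; have [c [k [B [D [ac cp Bc Bfree bnd]]]]] := H p.
have [K K0 near_K] := row_free_lower_bound Bc Bfree.
exists c, (K * D); split => //.
have cc : coord c @ p --> coord c p by exact: Defs.coord_continuous cp.
have near_c : \forall q \near p, dom c q.
  by apply: open_nbhs_nbhs; split => //; exact: dom_open.
have bnd' : \forall q \near p, forall t, I t -> dom c (gamma t) ->
  coord c (gamma t) = coord c q ->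
  `|derive1 (coord c \o gamma) t *m B (coord c q)| <= D := cc _ bnd.
have near_K' : \forall q \near p, forall v : 'rV[R]_n,
  `|v| <= K * `|v *m B (coord c q)| := cc _ near_K.
near=> q => t It gq.
have h1 : `|derive1 (coord c \o gamma) t| <=
    K * `|derive1 (coord c \o gamma) t *m B (coord c q)|.
  exact: (near near_K' q).
apply: (le_trans h1); apply: ler_wpM2l => //.
apply: (near bnd' q) => //; rewrite gq //.
by near: q.
Unshelve. all: by end_near. Qed.

End LowerBound.

(** * Matrices of alternating forms *)

Section AlternatingMatrix.
Context {R : realType} {n : nat}.

(** The matrix of an alternating form, in a basis formed by a vector [p] and a basis
    [(e_i)] of a complement: the form vanishes on the pairs of vectors [e_i] and
    takes the values [q] on the pairs [(p, e_i)]. *)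
Definition alternating_mx (q : 'rV[R]_n) : 'M[R]_(1 + n) :=
  block_mx (0 : 'M[R]_1) q (- q^T) 0.
Lemma alternating_mx_congr (q : 'rV[R]_n) (T : 'M[R]_n) :
  block_mx (1%:M : 'M[R]_1) 0 0 T *m alternating_mx q *m
    (block_mx (1%:M : 'M[R]_1) 0 0 T)^T = alternating_mx (q *m T^T).
Proof.
rewrite /alternating_mx tr_block_mx !mulmx_block !trmx1 !trmx0.
by rewrite !(mul1mx, mul0mx, mulmx0, mulmx1, addr0, add0r) mulmxN trmx_mul trmxK.
Qed.
(** When the frame moves by [A' = T A], the matrix [S] in this frame of a constant form
    satisfies [S' = T S + S T^T].  For the frame of a centroaffine hypersurface the
    right-hand side is again of the shape [alternating_mx], because the block that
    comes from the second fundamental form is [b *: q^T]. *)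
Lemma alternating_mx_derive (u q : 'rV[R]_n) (b : R) (K : 'M[R]_n) (p := q *m K^T) :
  let T := block_mx (0 : 'M[R]_1) u (b *: q^T) K in
  u *m q^T = q *m u^T ->
  T *m alternating_mx q + alternating_mx q *m T^T = alternating_mx p.
Proof.
move=> T uq; rewrite /alternating_mx tr_block_mx !mulmx_block !trmx0.
rewrite !(mul1mx, mul0mx, mulmx0, mulmx1, addr0, add0r) add_block_mx.
rewrite linearZ /= trmxK -!scalemxAl -!scalemxAr !(mulmxN, mulNmx) uq addNr.
by rewrite addr0 add0r scalerN subrr trmx_mul trmxK.
Qed.

Lemma is_derive_alternating_mx {V : normedModType R} (q : V -> 'rV[R]_n) t v dq :
  is_derive t v q dq ->
  is_derive t v (fun x => alternating_mx (q x)) (alternating_mx dq).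
Proof.
move=> hq; rewrite /alternating_mx /block_mx.
apply: is_derive_col_mx; apply: is_derive_row_mx => //.
by apply: is_deriveN; exact: is_derive_trmx.
Qed.
End AlternatingMatrix.

(** * Centroaffine hypersurfaces *)

Section Centroaffine.
Context {R : realType} {n : nat} {M : smooth_manifold R n}.
Variables (f xi : M -> 'rV[R]_n.+1) (nabla : connection M) (g : sym_tensor2 M).
Variables (o : 'rV[R]_n.+1) (a : R).
Hypothesis hgauss : gauss_formula f xi nabla g.
Hypothesis htrans : transversal f xi.
Hypothesis himm : immersion f.
Hypothesis hxi : forall p, xi p = a *: (f p - o).

Let phi (c : chart R n M) := f \o param c.

Definition position (p : M) : 'rV[R]_(1 + n) := f p - o.

Lemma phi_smooth c : atlas c -> smooth_on (img c) (phi c).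
Proof. by move=> ac; have [fs _] := himm; exact: fs. Qed.

Lemma pushforward_jacobian c x v : atlas c -> img c x ->
  pushforward f c x v = v *m 'J (phi c) x.
Proof.
move=> ac cx; have d := smooth_differentiable (phi_smooth ac) cx.
by rewrite -deriveEjacobian ?deriveE.
Qed.

(** The Gauss formula for fields that are constant in the chart: the covariant
    derivative reduces to the Christoffel symbols. *)
Lemma gauss_coordinates c x v w : atlas c -> img c x ->
  'D_v (fun y => 'D_w (phi c) y) x =
    christoffel nabla c x v w *m 'J (phi c) x +
    (a * g c x v w) *: position (param c x).
Proof.
move=> ac cx; rewrite -pushforward_jacobian//.
have := hgauss ac (@smooth_cst R _ _ (img c) v) (@smooth_cst R _ _ (img c) w) cx.
rewrite /covariant derive_cst add0r hxi scalerA mulrC => <-.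
apply: near_eq_derive.
have : \forall y \near x, img c y.
  by apply: open_nbhs_nbhs; split => //; exact: img_open.
apply: filterS => y cy; rewrite deriveE//.
exact: smooth_differentiable (phi_smooth ac) _ cy.
Qed.

Definition frame c x : 'M[R]_(1 + n) :=
  col_mx (position (param c x)) ('J (phi c) x).

(** Transversality of the position vector and immersivity, in one statement:
    the position vector and the coordinate vectors form a basis. *)
Lemma frame_unit c x : atlas c -> img c x -> frame c x \in unitmx.
Proof.
move=> ac cx; rewrite -row_free_unit; apply: row_free_of_inj => u.
rewrite -[u]hsubmxK mul_row_col; set l := lsubmx u; set v := rsubmx u.
rewrite -(pushforward_jacobian _ ac cx) [l]mx11_scalar mul_scalar_mx.
set b := l 0 0 => E.
have lin (r : R) w : pushforward f c x (r *: w) = r *: pushforward f c x w.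
  by rewrite !pushforward_jacobian// scalemxAl.
have b0 : b = 0.
  apply/eqP; apply: contrapT => /negP b0; have [_ tr] := htrans.
  apply: (tr c x ((- (a / b)) *: v) ac cx); rewrite lin.
  move: E => /eqP; rewrite addrC addr_eq0 => /eqP ->.
  by rewrite hxi scaleNr scalerN opprK scalerA divfK.
have v0 : v = 0.
  have [_ inj] := himm; apply: (inj c x ac cx).
  rewrite -[in RHS](scale0r v) lin scale0r.
  by move: E; rewrite b0 scale0r add0r.
by rewrite b0 v0 raddf0 row_mx0.
Qed.

Lemma position_continuous c x : atlas c -> img c x ->
  (fun y => position (param c y)) @ x --> position (param c x).
Proof.
move=> ac cx; have phic := differentiable_continuous
  (smooth_differentiable (phi_smooth ac) cx).
exact: (cvgB phic (cvg_cst o)).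
Qed.

Lemma phi_jacobian_continuous c x : atlas c -> img c x ->
  (fun y => 'J (phi c) y) @ x --> 'J (phi c) x.
Proof.
move=> ac cx; exact: jacobian_continuous (img_open (c := c)) (phi_smooth ac) cx.
Qed.

Section Curve.
Variables (nabla' : connection M) (I : set R) (gamma : R -> M).
Hypothesis geo : geodesic nabla' I gamma.

(** Differentiating the frame along a curve gives the velocity for the position
    vector, and the Gauss formula for the coordinate vectors. *)
Lemma derive_position c t : atlas c -> I t -> dom c (gamma t) ->
  let u := coord c \o gamma in
  is_derive t (1 : R) (position \o gamma) (derive1 u t *m 'J (phi c) (u t)).
Proof.
move=> ac It ct u; have [near_t du _] := geodesic_in_chart geo ac It ct.
have cut : img c (u t) by exact: img_coord.
have d := smooth_differentiable (phi_smooth ac) cut.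
apply: (@near_eq_is_derive _ _ _ ((phi c \o u) - cst o)).
  by apply: filterS near_t => s [_ cs]; rewrite !fctE /phi /u /= coordK.
rewrite -[derive1 u t *m _]subr0; apply: is_deriveB.
apply: is_derive_eq; first exact: is_derive_comp_diff du d.
by rewrite -deriveEjacobian ?deriveE.
Qed.

Lemma derive_jacobian c t : atlas c -> I t -> dom c (gamma t) ->
  let u := coord c \o gamma in
  exists2 J', is_derive t (1 : R) (fun s => 'J (phi c) (u s)) J' &
    forall w, w *m J' =
      christoffel nabla c (u t) (derive1 u t) w *m 'J (phi c) (u t) +
      (a * g c (u t) (derive1 u t) w) *: position (gamma t).
Proof.
move=> ac It ct u; have [_ du _] := geodesic_in_chart geo ac It ct.
have cut : img c (u t) by exact: img_coord.
have [J' dJ JE] := is_derive_jacobian (img_open (c := c))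
  (smooth_differentiable (phi_smooth ac))
  (smooth_derive_differentiable (phi_smooth ac)) cut du.
exists J' => // w; rewrite -JE gauss_coordinates//.
by rewrite /u /= coordK.
Qed.

End Curve.

(** * Geodesics of the induced connection *)

Section Primal.
Variables (I : set R) (gamma : R -> M).
Hypothesis geo : geodesic nabla I gamma.

Let N := position \o gamma.

(** The bivector [N /\ N'] is constant along a geodesic: the acceleration is
    radial (Kepler's law of areas). *)
Lemma areal_velocity_constant t1 t2 : I t1 -> I t2 ->
  (N t1)^T *m derive1 N t1 - (derive1 N t1)^T *m N t1 =
  (N t2)^T *m derive1 N t2 - (derive1 N t2)^T *m N t2.
Proof.
have [_ _ itvI _ _] := geo.
apply: (constant_of_derive0
  (f := fun s => (N s)^T *m derive1 N s - (derive1 N s)^T *m N s) itvI).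
move=> t It; have [c ac ct] := atlas_cover (gamma t).
pose u := coord c \o gamma.
have [near_t du ddu] := geodesic_in_chart geo ac It ct.
have dN := derive_position geo ac It ct.
have [J' dJ JE] := derive_jacobian geo ac It ct.
have near_N' : \forall s \near t,
    derive1 u s *m 'J (phi c) (u s) = derive1 N s.
  apply: filterS near_t => s [Is cs].
  by have [_ <-] := derive_position geo ac Is cs; rewrite derive1E.
have N't := nbhs_singleton near_N'.
have ddN : is_derive t (1 : R) (derive1 N)
    ((a * g c (u t) (derive1 u t) (derive1 u t)) *: N t).
  apply: near_eq_is_derive near_N' _.
  apply: is_derive_eq; first exact: (is_derive_mulmx ddu dJ).
  by rewrite JE mulNmx addrA addNr add0r.
have {}dN : is_derive t (1 : R) N (derive1 N t) by rewrite -N't; exact: dN.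
set k := a * _ in ddN.
have d1 := is_derive_mulmx (is_derive_trmx dN) ddN.
have d2 := is_derive_mulmx (is_derive_trmx ddN) dN.
apply: (is_derive_eq (is_deriveB d1 d2)).
have -> : (k *: N t)^T = k *: (N t)^T by rewrite linearZ.
rewrite -scalemxAl -scalemxAr [X in X - _]addrC.
exact: subrr.
Qed.

(** At each point, contraction with the position vector [P] sends [P /\ v] to a
    non-zero multiple of [v], up to a multiple of [P], and no non-zero tangent vector
    is a multiple of [P]. *)
Lemma primal_locally_bounded_velocity : locally_bounded_velocity I gamma.
Proof.
have [_ [t0 It0] _ _ _] := geo.
pose W0 := (N t0)^T *m derive1 N t0 - (derive1 N t0)^T *m N t0.
apply: locally_bounded_velocity_of_row_free => p.
have [c ac cp] := atlas_cover p; pose x0 := coord c p.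
have cx0 : img c x0 by exact: img_coord.
pose P x := position (param c x).
(* [w *m Q x] is the contraction of the bivector [P x /\ w] with [P x] *)
pose Q x : 'M[R]_(1 + n) := (P x *m (P x)^T) 0 0 *: 1%:M - (P x)^T *m P x.
exists c, (1 + n)%N, (fun x => 'J (phi c) x *m Q x),
  ((1 + n)%:R * (`|P x0| + 1) * `|W0|); split => //.
- have Jc := phi_jacobian_continuous ac cx0.
  have Pc : P @ x0 --> P x0 by exact: position_continuous.
  have PTc : (fun x => (P x)^T) @ x0 --> (P x0)^T.
    exact: (cvg_trmx (F := nbhs x0) Pc).
  have rc : (fun x => P x *m (P x)^T) @ x0 --> P x0 *m (P x0)^T.
    exact: (cvg_mulmx (F := nbhs x0) Pc PTc).
  have rc00 : (fun x => (P x *m (P x)^T) 0 0) @ x0 -->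
      (P x0 *m (P x0)^T) 0 0 by move/cvg_mxP : rc; exact.
  have PPc : (fun x => (P x)^T *m P x) @ x0 --> (P x0)^T *m P x0.
    exact: (cvg_mulmx (F := nbhs x0) PTc Pc).
  have Qc : Q @ x0 --> Q x0.
    have H := cvgB (cvgZ rc00 (cvg_cst (1%:M : 'M[R]_(1 + n)))) PPc.
    exact: (H _ _ _).
  exact: (cvg_mulmx (F := nbhs x0) Jc Qc).
- apply: row_free_of_inj => v; rewrite mulmxA mulmxBr -scalemxAr mulmx1 mulmxA.
  set w := v *m 'J (phi c) x0; set r := (_ *m _) 0 0.
  rewrite [w *m _]mx11_scalar mul_scalar_mx; set b := (w *m _) 0 0 => E.
  have uA := frame_unit ac cx0.
  have r0 : r != 0.
    rewrite /r mxE psumr_neq0 => [|i _]; last by rewrite [X in _ * X]mxE -expr2 sqr_ge0.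
    have : P x0 != 0.
      apply/eqP => P0; have [_ /(_ c x0 0 ac cx0)] := htrans.
      by rewrite pushforward_jacobian// mul0mx hxi -/(position _) -/(P x0) P0 scaler0.
    apply: contraNT => /hasPn H; apply/eqP/rowP => i; rewrite [RHS]mxE.
    apply/eqP; rewrite -sqrf_eq0 eq_le sqr_ge0 andbT leNgt.
    by have := H i (mem_index_enum _); rewrite [X in _ * X]mxE expr2.
  have : row_mx (- b)%:M (r *: v) *m frame c x0 = 0.
    by rewrite mul_row_col mul_scalar_mx -scalemxAl scaleNr addrC.
  move=> /(congr1 (mulmxr (invmx (frame c x0)))) /=.
  rewrite mulmxK// mul0mx -row_mx0 => /eq_row_mx[_ /eqP].
  by rewrite scaler_eq0 (negPf r0) => /eqP.
- have := near_norm_le (position_continuous ac cx0); apply: filterS => x Px t It ct ctx.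
  have dN := derive_position geo ac It ct.
  have N't : derive1 (coord c \o gamma) t *m 'J (phi c) x = derive1 N t.
    by case: dN => _; rewrite /= ctx => <-; rewrite derive1E.
  have Nt : N t = P x by rewrite /P -ctx coordK.
  have -> : derive1 (coord c \o gamma) t *m ('J (phi c) x *m Q x) = P x *m W0.
    rewrite mulmxA N't /W0 (areal_velocity_constant It0 It) Nt.
    rewrite /Q; move: (P x) (derive1 N t) => q q1.
    rewrite !mulmxBr !mulmxA -scalemxAr mulmx1.
    have -> : q1 *m q^T = q *m q1^T.
      by rewrite [LHS]mx11_scalar -tr_scalar_mx -mx11_scalar trmx_mul trmxK.
    by rewrite -mul_scalar_mx -mx11_scalar.
  apply: (le_trans (mulmx_norm_le _ _)); apply: ler_wpM2r => //.
  by apply: ler_wpM2l => //; rewrite ler0n.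
Qed.

End Primal.

(** * Geodesics of the dual connection *)

Section Dual.
Variable nablabar : connection M.
Hypothesis hdual : dual_connection g nabla nablabar.
Hypothesis hnondeg : nondegenerate g.

Definition metric_mx c x : 'M[R]_n :=
  \matrix_(i, j) g c x (delta_mx 0 i) (delta_mx 0 j).

Definition christoffel_mx (nab : connection M) c x v : 'M[R]_n :=
  \matrix_(i < n) christoffel nab c x v (delta_mx 0 i).

Lemma christoffel_mxE (nab : connection M) c x v w : atlas c -> img c x ->
  christoffel nab c x v w = w *m christoffel_mx nab c x v.
Proof.
move=> ac cx; rewrite (linear_row_sum _ (christoffel_linearr nab v ac cx)).
by rewrite mulmx_sum_row; apply: eq_bigr => i _; rewrite rowK.
Qed.

Lemma form_row_sum c x v w : atlas c -> img c x ->
  g c x v w = \sum_j w 0 j * g c x v (delta_mx 0 j).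
Proof.
move=> ac cx.
exact: (linear_row_sum (W := [the lmodType R of R^o]) w (form_linear g v ac cx)).
Qed.

Lemma metric_mxE c x v i : atlas c -> img c x ->
  (v *m metric_mx c x) 0 i = g c x v (delta_mx 0 i).
Proof.
move=> ac cx; rewrite mxE form_sym// form_row_sum//.
by apply: eq_bigr => j _; rewrite mxE form_sym.
Qed.

Lemma form_mulmx c x v w : atlas c -> img c x ->
  g c x v w = (v *m metric_mx c x *m w^T) 0 0.
Proof.
move=> ac cx; rewrite form_row_sum// mxE; apply: eq_bigr => j _.
by rewrite metric_mxE// mxE mulrC.
Qed.

Lemma metric_mx_row_free c x : atlas c -> img c x -> row_free (metric_mx c x).
Proof.
move=> ac cx; apply: row_free_of_inj => v v0.
by apply: (hnondeg ac cx) => w; rewrite form_mulmx// v0 mul0mx mxE.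
Qed.

Lemma metric_mx_continuous c x : atlas c -> img c x ->
  (fun y => metric_mx c y) @ x --> metric_mx c x.
Proof.
move=> ac cx; apply/(@cvg_mxP R _ (nbhs x) (nbhs_filter x)) => i j.
rewrite mxE; under eq_fun do rewrite mxE.
have gs := form_smooth g (delta_mx 0 i) (delta_mx 0 j) ac.
exact: (differentiable_continuous (smooth_differentiable gs cx)).
Qed.

(** Duality for fields that are constant in the chart. *)
Lemma dual_coordinates c x v w z : atlas c -> img c x ->
  'D_v (fun y => g c y w z) x =
    g c x (christoffel nabla c x v w) z + g c x w (christoffel nablabar c x v z).
Proof.
move=> ac cx; have := hdual ac (@smooth_cst R _ _ (img c) v)
  (@smooth_cst R _ _ (img c) w) (@smooth_cst R _ _ (img c) z) cx.
by rewrite /covariant !derive_cst !add0r.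
Qed.

(** The matrix in the standard basis of the alternating form which, in the frame at
    [x], has the matrix [alternating_mx] attached to the covector [g(v, _)].  If [nu]
    is the conormal map, this form is [- a (nu /\ D_v nu)]. *)
Definition conormal_bivector c x v : 'M[R]_(1 + n) :=
  invmx (frame c x) *m alternating_mx (v *m metric_mx c x) *m
  (invmx (frame c x))^T.

Lemma conormal_bivectorP c x v : atlas c -> img c x ->
  frame c x *m conormal_bivector c x v *m (frame c x)^T =
  alternating_mx (v *m metric_mx c x).
Proof.
move=> ac cx; have uA := frame_unit ac cx.
by rewrite !mulmxA mulmxV// mul1mx -mulmxA -trmx_mul mulmxV// trmx1 mulmx1.
Qed.

Lemma conormal_bivector_unique c x v (W : 'M[R]_(1 + n)) :
  atlas c -> img c x ->
  frame c x *m W *m (frame c x)^T = alternating_mx (v *m metric_mx c x) ->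
  W = conormal_bivector c x v.
Proof.
move=> ac cx E; have uA := frame_unit ac cx.
rewrite /conormal_bivector -E !mulmxA mulVmx// mul1mx -mulmxA -trmx_mul.
by rewrite mulVmx// trmx1 mulmx1.
Qed.

Lemma jacobian_chart_change c d x : atlas c -> atlas d -> overlap c d x ->
  'J (phi c) x = 'J (transition c d) x *m 'J (phi d) (transition c d x).
Proof.
move=> ac ad ox; have [cx dx] := ox; set tau := transition c d.
have taud : differentiable tau x := smooth_differentiable (atlas_smooth ac ad) ox.
have dtx : img d (tau x) by exact: img_coord.
have phid := smooth_differentiable (phi_smooth ad) dtx.
have phic := smooth_differentiable (phi_smooth ac) cx.
have comp w : 'D_w (phi c) x = 'd (phi d) (tau x) ('d tau x w).
  rewrite (@near_eq_derive _ _ _ _ (phi d \o tau)).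
    exact: derive_comp taud phid.
  have : \forall y \near x, overlap c d y.
    by apply: open_nbhs_nbhs; split => //; exact: overlap_open.
  by apply: filterS => y [cy dy]; rewrite /phi /tau /transition /= coordK.
apply/row_matrixP => i; rewrite !rowE mulmxA.
rewrite -(deriveEjacobian _ phic) comp -(deriveE _ phid) (deriveEjacobian _ phid).
by rewrite -(deriveE _ taud) (deriveEjacobian _ taud).
Qed.

(** A change of chart multiplies the frame by a block matrix [P] and carries the
    matrix of values [S] to [P S P^T]: the form does not change. *)
Lemma conormal_bivector_chart_change c d x v :
  atlas c -> atlas d -> overlap c d x ->
  conormal_bivector d (transition c d x) ('d (transition c d) x v) =
  conormal_bivector c x v.
Proof.
move=> ac ad ox; have [cx dx] := ox.
set tau := transition c d; have dtx : img d (tau x) by exact: img_coord.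
have taud : differentiable tau x := smooth_differentiable (atlas_smooth ac ad) ox.
have dE w : 'd tau x w = w *m 'J tau x by rewrite -deriveEjacobian ?deriveE.
apply: conormal_bivector_unique => //.
pose P : 'M[R]_(1 + n) := block_mx (1%:M : 'M[R]_1) 0 0 ('J tau x).
have -> : frame c x = P *m frame d (tau x).
  rewrite mul_block_col mul1mx !mul0mx addr0 add0r -jacobian_chart_change//.
  by rewrite /frame /tau /transition /= coordK.
have metricE : metric_mx c x = 'J tau x *m metric_mx d (tau x) *m ('J tau x)^T.
  apply/matrixP => i j; rewrite mxE -(form_transform g _ _ ac ad ox) form_mulmx//.
  rewrite !dE -!rowE -row_mul mxE [RHS]mxE.
  by apply: eq_bigr => k _; rewrite !mxE.
have assoc (F W : 'M[R]_(1 + n)) :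
    P *m F *m W *m (P *m F)^T = P *m (F *m W *m F^T) *m P^T.
  by rewrite trmx_mul !mulmxA.
rewrite assoc conormal_bivectorP// dE metricE.
by rewrite alternating_mx_congr !mulmxA.
Qed.

Section DualCurve.
Variables (I : set R) (gamma : R -> M).
Hypothesis geo : geodesic nablabar I gamma.

(** Duality in matrix form.  By symmetry of the metric it can also be written with
    the two connections exchanged; the order chosen here lets the term in the dual
    connection cancel against the acceleration of a geodesic. *)
Lemma derive_metric c t : atlas c -> I t -> dom c (gamma t) ->
  let u := coord c \o gamma in
  let K := christoffel_mx nabla c (u t) (derive1 u t) in
  let K' := christoffel_mx nablabar c (u t) (derive1 u t) in
  is_derive t (1 : R) (fun s => metric_mx c (u s))
    (metric_mx c (u t) *m K^T + K' *m metric_mx c (u t)).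
Proof.
move=> ac It ct u K K'; have [_ du _] := geodesic_in_chart geo ac It ct.
have cut : img c (u t) by exact: img_coord.
apply/is_derive_mxP => i j.
have gs := form_smooth g (delta_mx 0 j) (delta_mx 0 i) ac.
have gd := smooth_differentiable gs cut.
apply: (@near_eq_is_derive _ _ _
    ((fun y => g c y (delta_mx 0 j) (delta_mx 0 i)) \o u)).
  have [near_t _ _] := geodesic_in_chart geo ac It ct.
  apply: filterS near_t => s [_ cs]; rewrite mxE /= form_sym//.
  exact: img_coord.
apply: (is_derive_eq (is_derive_comp_diff du gd)).
rewrite -deriveE// dual_coordinates// !mxE; congr (_ + _).
  rewrite form_sym// form_row_sum//.
  by apply: eq_bigr => k _; rewrite !mxE mulrC.
rewrite form_row_sum//.
by apply: eq_bigr => k _; rewrite !mxE form_sym.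
Qed.

(** The structure equations [A' = T A] of the frame. *)
Lemma derive_frame c t : atlas c -> I t -> dom c (gamma t) ->
  let u := coord c \o gamma in
  let q := derive1 u t *m metric_mx c (u t) in
  let K := christoffel_mx nabla c (u t) (derive1 u t) in
  is_derive t (1 : R) (fun s => frame c (u s))
    (block_mx (0 : 'M[R]_1) (derive1 u t) (a *: q^T) K *m frame c (u t)).
Proof.
move=> ac It ct u q K; have cut : img c (u t) by exact: img_coord.
have [near_t _ _] := geodesic_in_chart geo ac It ct.
have dN := derive_position geo ac It ct.
have [J' dJ JE] := derive_jacobian geo ac It ct.
apply: (is_derive_eq (is_derive_col_mx
  (A := fun s => position (param c (u s))) (near_eq_is_derive _ dN) dJ)).
  by apply: filterS near_t => s [_ cs]; rewrite /u /= coordK.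
rewrite mul_block_col mul0mx add0r; congr col_mx.
apply/row_matrixP => i; rewrite !rowE JE mulmxDr !mulmxA addrC.
rewrite (christoffel_mxE _ _ _ ac cut); congr (_ + _).
rewrite -scalemxAr -scalemxAl -scalerA; congr (_ *: _).
have -> : delta_mx 0 i *m q^T = (g c (u t) (derive1 u t) (delta_mx 0 i))%:M.
  rewrite [LHS]mx11_scalar -rowE; congr (_ %:M).
  by rewrite mxE mxE metric_mxE.
by rewrite mul_scalar_mx /u /= coordK.
Qed.

(** From [W = A^-1 S A^-T], [A' = T A] and [S' = T S + S T^T] one finds [W' = 0]. *)
Lemma derive_conormal_bivector c t : atlas c -> I t -> dom c (gamma t) ->
  let u := coord c \o gamma in
  is_derive t (1 : R) (fun s => conormal_bivector c (u s) (derive1 u s)) 0.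
Proof.
move=> ac It ct u; have cut : img c (u t) by exact: img_coord.
have [near_t _ ddu] := geodesic_in_chart geo ac It ct.
pose G := metric_mx c (u t); pose q := derive1 u t *m G.
pose K := christoffel_mx nabla c (u t) (derive1 u t).
pose K' := christoffel_mx nablabar c (u t) (derive1 u t).
pose A := frame c (u t).
pose T := block_mx (0 : 'M[R]_1) (derive1 u t) (a *: q^T) K.
have dG : is_derive t (1 : R) (fun s => metric_mx c (u s))
  (G *m K^T + K' *m G) := derive_metric ac It ct.
have dA : is_derive t (1 : R) (fun s => frame c (u s)) (T *m A) :=
  derive_frame ac It ct.
have uA : \forall s \near t, frame c (u s) \in unitmx.
  by apply: filterS near_t => s [_ cs]; apply: frame_unit => //; exact: img_coord.
have dq : is_derive t (1 : R) (fun s => derive1 u s *m metric_mx c (u s))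
    (q *m K^T).
  apply: (is_derive_eq (is_derive_mulmx ddu dG)).
  rewrite (christoffel_mxE _ _ _ ac cut) -/K' -/G mulmxDr !mulmxA -/q.
  by rewrite addrC mulNmx addrK.
have dB := is_derive_invmx uA dA.
have dS := is_derive_alternating_mx dq.
have dW := is_derive_mulmx (is_derive_mulmx dB dS) (is_derive_trmx dB).
apply: (is_derive_eq dW); rewrite -/A -/G -/q.
have uAt : A \in unitmx := nbhs_singleton uA.
rewrite !mulmxA (mulmxK uAt).
have <- : T *m alternating_mx q + alternating_mx q *m T^T =
    alternating_mx (q *m K^T).
  apply: alternating_mx_derive.
  by rewrite [LHS]mx11_scalar -tr_scalar_mx -mx11_scalar trmx_mul trmxK.
have -> : (- (invmx A *m T))^T = - (T^T *m (invmx A)^T).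
  by rewrite linearN /= trmx_mul.
by rewrite mulNmx mulmxDr !mulmxA addKr mulmxN !mulmxA subrr.
Qed.

Lemma conormal_bivector_curve_chart c d t : atlas c -> atlas d -> I t ->
  dom c (gamma t) -> dom d (gamma t) ->
  conormal_bivector c (coord c (gamma t)) (derive1 (coord c \o gamma) t) =
  conormal_bivector d (coord d (gamma t)) (derive1 (coord d \o gamma) t).
Proof.
move=> ac ad It ct dt; pose u := coord c \o gamma.
have ox : overlap c d (u t) by split; [exact: img_coord|rewrite /u /= coordK].
have [near_t du _] := geodesic_in_chart geo ac It ct.
have taud : differentiable (transition c d) (u t).
  exact: smooth_differentiable (atlas_smooth ac ad) _ ox.
have -> : derive1 (coord d \o gamma) t = 'd (transition c d) (u t) (derive1 u t).
  have [_ <-] := is_derive_comp_diff du taud; rewrite derive1E.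
  apply: near_eq_derive.
  by apply: filterS near_t => s [_ cs]; rewrite /transition /= coordK.
have -> : coord d (gamma t) = transition c d (u t).
  by rewrite /transition /u /= coordK.
exact/esym/conormal_bivector_chart_change.
Qed.

(** The derivative vanishes in every chart; independence of the chart makes the
    constants agree along the whole curve. *)
Lemma conormal_bivector_constant : exists W, forall c t, atlas c -> I t ->
  dom c (gamma t) ->
  conormal_bivector c (coord c (gamma t)) (derive1 (coord c \o gamma) t) = W.
Proof.
have [_ [t0 It0] itvI _ _] := geo.
have /choice[ch Hch] t : exists c, atlas c /\ dom c (gamma t).
  by have [c ac ct] := atlas_cover (gamma t); exists c.
pose W t := conormal_bivector (ch t) (coord (ch t) (gamma t))
  (derive1 (coord (ch t) \o gamma) t).
have WE c t : atlas c -> I t -> dom c (gamma t) ->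
    conormal_bivector c (coord c (gamma t)) (derive1 (coord c \o gamma) t) = W t.
  by move=> ac It ct; have [ad dt] := Hch t; exact: conormal_bivector_curve_chart.
have dW s : I s -> is_derive s (1 : R) W 0.
  move=> Is; have [ad ds] := Hch s.
  apply: near_eq_is_derive (derive_conormal_bivector ad Is ds).
  have [near_s _ _] := geodesic_in_chart geo ad Is ds.
  by apply: filterS near_s => r [Ir dr]; exact: WE.
exists (W t0) => c t ac It ct; apply: (eq_trans (WE c t ac It ct)).
exact: (constant_of_derive0 itvI dW It It0).
Qed.

(** The covector [g(gamma', _)] is the value of a constant form on the position
    vector and the coordinate vectors, which are locally bounded; [g] is
    non-degenerate. *)
Lemma dual_locally_bounded_velocity : locally_bounded_velocity I gamma.
Proof.
have [W HW] := conormal_bivector_constant.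
apply: locally_bounded_velocity_of_row_free => p.
have [c ac cp] := atlas_cover p; pose x0 := coord c p.
have cx0 : img c x0 by exact: img_coord.
pose P x := position (param c x); pose J x := 'J (phi c) x.
exists c, n, (fun x => metric_mx c x), ((1 + n)%:R * ((1 + n)%:R *
  (`|P x0| + 1) * `|W|) * (`|J x0| + 1)); split => //.
- exact: metric_mx_continuous.
- exact: metric_mx_row_free.
have near_P := near_norm_le (position_continuous ac cx0).
have near_J := near_norm_le (phi_jacobian_continuous ac cx0).
near=> x => t It ct ctx.
have cx : img c x by rewrite -ctx; exact: img_coord.
have E := conormal_bivectorP (derive1 (coord c \o gamma) t) ac cx.
have W_eq := HW c t ac It ct; rewrite ctx in W_eq.
move: E; rewrite W_eq /frame mul_col_mx tr_col_mx mul_col_row.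
move=> /eq_block_mx[_ <- _ _].
have Px : `|P x| <= `|P x0| + 1 by near: x.
have Jx : `|J x| <= `|J x0| + 1 by near: x.
apply: (le_trans (mulmx_norm_le _ _)); apply: ler_pM => //.
- apply: ler_wpM2l; first exact: ler0n.
  apply: (le_trans (mulmx_norm_le _ _)); apply: ler_wpM2r => //.
  by apply: ler_wpM2l; first exact: ler0n.
- exact: le_trans (norm_trmx_le _) Jx.
Unshelve. all: by end_near. Qed.

End DualCurve.

End Dual.

End Centroaffine.

Theorem theorem5p4 (R : realType) (n : nat) (M : smooth_manifold R n)
    (f xi : M -> 'rV[R]_n.+1) (nabla nablabar : connection M)
    (g : sym_tensor2 M)
    (hgauss : gauss_formula f xi nabla g)
    (hcentro : centroaffine f xi)
    (hoval : ovaloid f g)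
    (hdual : dual_connection g nabla nablabar) :
  complete_connection nabla /\ complete_connection nablabar.
Proof.
have [htrans [ctr [a [_ hxi]]]] := hcentro.
have [hsphere himm hnondeg _] := hoval.
split=> I gamma maxI; apply: (maximal_geodesic_complete hsphere maxI).
  exact: (primal_locally_bounded_velocity hgauss htrans himm hxi maxI.1).
exact: (dual_locally_bounded_velocity hgauss htrans himm hxi hdual hnondeg maxI.1).
Qed.
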